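(* Let $H$ be a fixed multicyclic connected planar graph, and let $m(n)$ be non-negative integers with $m(n)\le (1+o(1))n$. Then \[ \mathbf{P}[P_{n,m}\text{ has a component isomorphic to } H]\to 0 \quad\text{as } n\to\infty. \]
   Context: $\mathcal{P}(n,m)$ denotes the set of all (simple, labelled) planar graphs on the vertex set $\{1,2,\ldots,n\}$ with exactly $m$ edges, and $P_{n,m}$ denotes a graph chosen uniformly at random from $\mathcal{P}(n,m)$. A connected graph $H$ is multicyclic if $e(H)>|H|$, where $e(H)$ is its number of edges and $|H|$ its number of vertices. *)

(* Defs.v *)
From HB Require Import structures.
From mathcomp Require Import all_boot all_order all_algebra.
From mathcomp Require Import all_classical all_reals all_analysis.

Set Implicit Arguments.
Unset Strict Implicit.
Unset Printing Implicit Defensive.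

Import Order.TTheory GRing.Theory Num.Theory.
Import numFieldNormedType.Exports.

Local Open Scope ring_scope.

(* A simple graph on the vertex type T is given by its edge set, a set of
   two-element subsets of T. *)
Definition is_graph (T : finType) (E : {set {set T}}) : bool :=
  [forall e in E, #|e| == 2].

Definition adj (T : finType) (E : {set {set T}}) : rel T :=
  fun x y => [set x; y]%SET \in E.

Definition connected_graph (T : finType) (E : {set {set T}}) : Prop :=
  (0 < #|T|)%N /\ forall x y : T, connect (adj E) x y.

Definition multicyclic (T : finType) (E : {set {set T}}) : Prop :=
  connected_graph E /\ (#|T| < #|E|)%N.

(* A drawing of E in the plane R * R: [p] places the vertices and [g e], on the
   unit interval, parametrizes the simple arc that represents the edge e. *)
Definition plane_drawing (R : realType) (T : finType) (E : {set {set T}})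
    (p : T -> R * R) (g : {set T} -> R -> R * R) : Prop :=
  [/\ injective p,
      forall e, e \in E ->
        [/\ {within `[0, 1], continuous (g e)}%classic,
            {in `[0, 1] &, injective (g e)} &
            exists x y : T, [/\ e = [set x; y]%SET, g e 0 = p x & g e 1 = p y]],
      forall e (x : T) (t : R), e \in E -> t \in `]0, 1[ -> g e t <> p x &
      forall e f (s t : R), e \in E -> f \in E -> e != f ->
        s \in `]0, 1[ -> t \in `]0, 1[ -> g e s <> g f t].

Definition planar (R : realType) (T : finType) (E : {set {set T}}) : Prop :=
  exists (p : T -> R * R) (g : {set T} -> R -> R * R), plane_drawing E p g.

(* The vertices {1, ..., n} are represented by 'I_n = {0, ..., n - 1}. *)
Definition planar_graphs (R : realType) (n m : nat) : {set {set {set 'I_n}}} :=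
  [set E : {set {set 'I_n}} |
    [&& is_graph E, #|E| == m & `[< planar R E >]]]%SET.

Definition components (T : finType) (E : {set {set T}}) : {set {set T}} :=
  [set [set y | connect (adj E) x y] | x : T]%SET.

Definition has_component_iso (U T : finType) (EH : {set {set U}})
    (E : {set {set T}}) : bool :=
  [exists C in components E, exists f : {ffun U -> T},
    [&& injectiveb f, (f @: [set: U])%SET == C &
        [forall x, forall y, adj EH x y == adj E (f x) (f y)]]].

(* Probability of Q under the uniform distribution on A; it is 0 by convention
   when A is empty. *)
Definition uniform_probability (R : realType) (X : finType) (A : {set X})
    (Q : pred X) : R :=
  #|[set x in A | Q x]%SET|%:R / #|A|%:R.

(* Main.v *)
(** Multigraphs are used because subdividing, suppressing or doubling edges is
    then always possible.  Call a pair of vertices addable if joining them keeps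
    the graph planar.  Peeling off isolated vertices, leaves and vertices of
    degree two labels the vertices in such a way that any two vertices with the
    same label are addable: a leaf inherits the label of its neighbour, and of two
    adjacent vertices of degree two one inherits the label of the other.  What
    cannot be peeled has minimum degree two and no two adjacent vertices of degree
    two, so it has at most [5 (m - n)] vertices.  Hence, if [m <= (1 + o(1)) n],
    either there are many tree components (which share one label) or there are
    only [o(n)] labels; both ways there are more than [K n] addable pairs.  Double
    counting gives [|P(n, m)| = o(|P(n, m + 1)|)] uniformly.

    Now dissolve a component isomorphic to [H] (with [h] vertices and [h + c]
    edges, [c >= 1]) by deleting its edges and hanging its vertices as leaves on
    the rest of the graph.  This has about [n ^ h] outcomes, and the outcome
    together with the [h] leaves determines the graph, so that at most
    [O(1) |P(n, m - c)| = o(|P(n, m)|)] graphs have such a component.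

    The only topology needed is that a drawing can be straightened near a given
    vertex: replace every arc there by a radius up to its last exit from a small
    disc.  All new edges are then drawn inside that disc. *)

Require Import Defs.
From HB Require Import structures.
From mathcomp Require Import all_boot all_order all_algebra.
From mathcomp Require Import perm.
From mathcomp Require Import all_classical all_reals all_analysis.
From mathcomp Require Import ring lra zify.

Set Implicit Arguments.
Unset Strict Implicit.
Unset Printing Implicit Defensive.

Import Order.TTheory GRing.Theory Num.Theory.
Import numFieldNormedType.Exports.

Local Open Scope classical_set_scope.
Local Open Scope ring_scope.

(** * Simple arcs in the plane *)

Section Arcs.
Variable R : realType.
Implicit Types (a b c d x z : R * R) (A B : set (R * R)).

(** The retraction of the line onto the unit interval; composing with it extends a path to all of
    [R]. *)
Definition clamp (t : R) : R := Num.max 0 (Num.min 1 t).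

Lemma clamp_continuous : continuous clamp.
Proof.
move=> t; apply: (@continuous_max R R (cst (0 : R)) (fun t => Num.min 1 t)).
  exact: cvg_cst.
apply: (@continuous_min R R (cst (1 : R)) id); first exact: cvg_cst.
exact: cvg_id.
Qed.

Lemma clamp_in t : clamp t \in `[0, 1].
Proof. by rewrite in_itv /= /clamp le_max lexx /= ge_max ler01 ge_min lexx. Qed.

Lemma clamp_id t : t \in `[0, 1] -> clamp t = t.
Proof.
rewrite in_itv /= /clamp => /andP[t0 t1].
by rewrite (min_idPr t1) (max_idPr t0).
Qed.

Lemma clamp_le0 t : t <= 0 -> clamp t = 0.
Proof.
move=> t0; rewrite /clamp; apply/max_idPl.
by rewrite (min_idPr _) //; lra.
Qed.

Lemma clamp_ge1 t : 1 <= t -> clamp t = 1.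
Proof. by move=> t1; rewrite /clamp (min_idPl t1); apply/max_idPr; lra. Qed.

(** An arc is a point set, so that it can be cut, joined and reversed without tracking
    parametrizations. *)
Definition simple_arc A a b := exists g : R -> R * R,
  [/\ continuous g, {in `[0, 1] &, injective g}, g 0 = a, g 1 = b
    & A = g @` `[0, 1]].

Lemma image_clamp (g : R -> R * R) t : (g @` `[0, 1]) (g (clamp t)).
Proof. by exists (clamp t) => //=; exact: clamp_in. Qed.

Lemma within_arc (g : R -> R * R) :
  {within `[0, 1], continuous g} -> {in `[0, 1] &, injective g} ->
  simple_arc (g @` `[0, 1]) (g 0) (g 1).
Proof.
move=> /subspace_continuousP gc gi; exists (g \o clamp); split => /=.
- move=> t.
  apply: (@cvg_comp _ _ _ clamp g _ (within [set` `[0, 1]] (nbhs (clamp t)))).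
    move=> S /= /(@clamp_continuous t) /= H.
    by apply: (@filterS _ (nbhs t) _ _ _ _ H) => s /=; apply; exact: clamp_in.
  by apply: gc; exact: clamp_in.
- by move=> s t s01 t01 /=; rewrite !clamp_id//; apply: gi.
- by rewrite clamp_le0.
- by rewrite clamp_ge1.
- apply/seteqP; split => z [t t01 <-].
    by exists t => //=; rewrite clamp_id.
  by exists (clamp t) => //=; exact: clamp_in.
Qed.

Lemma arc_sub (g : R -> R * R) (s t : R) :
  continuous g -> {in `[0, 1] &, injective g} -> 0 <= s -> s < t -> t <= 1 ->
  simple_arc (g @` `[s, t]) (g s) (g t).
Proof.
move=> gc gi s0 st t1.
have e01 u : u \in `[0, 1] -> s + u * (t - s) \in `[s, t].
  by rewrite !in_itv /= => /andP[? ?]; apply/andP; split; nra.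
have e01' u : u \in `[0, 1] -> s + u * (t - s) \in `[0, 1].
  by move/e01; rewrite !in_itv /= => /andP[? ?]; apply/andP; split; lra.
exists (fun u => g (s + u * (t - s))); split.
- move=> u; apply: (@continuous_comp _ _ _ (fun u : R => s + u * (t - s)) g).
    apply: cvgD; first exact: cvg_cst.
    by apply: cvgM; [exact: cvg_id|exact: cvg_cst].
  exact: gc.
- move=> u v u01 v01 /gi; rewrite !e01' // => /(_ isT isT) e.
  have : (u - v) * (t - s) = 0 by lra.
  by move/eqP; rewrite mulf_eq0 !subr_eq0 (gt_eqF st) orbF => /eqP.
- by rewrite mul0r addr0.
- by congr g; lra.
- apply/seteqP; split => z [u u01 <-].
    exists ((u - s) / (t - s)).
      move: u01; rewrite /= !in_itv /= => /andP[? ?]; apply/andP; split.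
        by apply: divr_ge0; lra.
      by rewrite ler_pdivrMr; lra.
    by rewrite /= divfK; [congr g; lra | lra].
  by exists (s + u * (t - s)) => //=; exact: e01.
Qed.

Lemma arc_l A a b : simple_arc A a b -> A a.
Proof. by case=> g [_ _ <- _ ->]; exists 0; rewrite //= in_itv /= lexx ler01. Qed.

Lemma arc_sym A a b : simple_arc A a b -> simple_arc A b a.
Proof.
case=> g [gc gi g0 g1 ->].
have e01 u : u \in `[0, 1] -> 1 - u \in `[0, 1 : R].
  by rewrite !in_itv /= => /andP[? ?]; apply/andP; split; lra.
exists (fun u => g (1 - u)); split.
- move=> u; apply: (@continuous_comp _ _ _ (fun u : R => 1 - u) g).
    by apply: cvgB; [exact: cvg_cst|exact: cvg_id].
  exact: gc.
- by move=> u v u01 v01 /gi; rewrite !e01 // => /(_ isT isT) e; lra.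
- by rewrite subr0.
- by rewrite subrr.
- apply/seteqP; split => z [u u01 <-]; exists (1 - u) => /=.
  + exact: e01.
  + by rewrite subKr.
  + exact: e01.
  + by [].
Qed.

Lemma arc_r A a b : simple_arc A a b -> A b.
Proof. by move/arc_sym/arc_l. Qed.

Lemma arc_neq A a b : simple_arc A a b -> a <> b.
Proof.
case=> g [_ gi <- <- _] /gi; rewrite !in_itv /= !lexx ler01 => /(_ isT isT).
by move/eqP; rewrite eq_sym oner_eq0.
Qed.

Lemma arc_bounded A a b : simple_arc A a b -> exists m, forall z, A z -> `|z| <= m.
Proof.
case=> g [gc _ _ _ ->].
have [|c _ cm] := @EVT_max R (fun t => `|g t|) 0 1 ler01.
  apply: continuous_subspaceT => t.
  by apply: continuous_comp; [exact: gc|exact: norm_continuous].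
by exists `|g c| => z [t t01 <-]; exact: cm.
Qed.

Lemma arc_away A a b c : simple_arc A a b -> ~ A c ->
  exists2 r, 0 < r & forall z, A z -> r <= `|z - c|.
Proof.
case=> g [gc _ _ _ ->] nAc.
have [|s s01 sm] := @EVT_min R (fun t => `|g t - c|) 0 1 ler01.
  apply: continuous_subspaceT => t.
  apply: (@continuous_comp _ _ _ (fun t => g t - c) Num.norm).
    by apply: cvgB; [exact: gc|exact: cvg_cst].
  exact: norm_continuous.
exists `|g s - c|; last by move=> z [t t01 <-]; exact: sm.
rewrite normr_gt0 subr_eq0; apply/eqP => e; apply: nAc.
by exists s.
Qed.

Definition seg a b : set (R * R) :=
  [set z | exists2 t : R, 0 <= t <= 1 & z = a + t *: (b - a)].

Lemma arc_seg a b : a <> b -> simple_arc (seg a b) a b.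
Proof.
move=> ab; exists (fun t => a + t *: (b - a)); split.
- move=> t; apply: cvgD; first exact: cvg_cst.
  by apply: cvgZr_tmp; exact: cvg_id.
- move=> s t _ _ /addrI /eqP; rewrite -subr_eq0 -scalerBl scaler_eq0 !subr_eq0.
  by case/orP => /eqP // /esym.
- by rewrite scale0r addr0.
- by rewrite scale1r addrC subrK.
- apply/seteqP; split => z [t t01 e]; exists t => //.
Qed.

Lemma arc_cat A B a b c : simple_arc A a b -> simple_arc B b c ->
  (forall z, A z -> B z -> z = b) -> simple_arc (A `|` B) a c.
Proof.
case=> g [gc gi g0 g1 ->] [h [hc hi h0 h1 ->]] AB.
(* At every [t] one of the two clamped terms equals [b], and subtracting [b] leaves the other. This
   form makes continuity immediate. *)
pose k t := g (clamp (2 * t)) + h (clamp (2 * t - 1)) - b.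
have kl t : t <= 1 / 2 -> k t = g (clamp (2 * t)).
  by move=> ?; rewrite /k (@clamp_le0 (_ - 1)) ?h0 ?addrK //; lra.
have kr t : 1 / 2 <= t -> k t = h (clamp (2 * t - 1)).
  by move=> ?; rewrite /k (@clamp_ge1 (2 * t)) ?g1 1?addrC ?addKr //; lra.
have mix s t : s \in `[0, 1] -> t \in `[0, 1] -> s <= 1 / 2 -> 1 / 2 <= t ->
    k s = k t -> s = t.
  move=> s01 t01 s2 t2; rewrite kl // kr // => e.
  have := AB (g (clamp (2 * s))) (image_clamp _ _).
  rewrite {1}e => /(_ (image_clamp _ _)) eb.
  move: s01 t01; rewrite !in_itv /= => s01 t01.
  have : g (clamp (2 * s)) = g 1 by rewrite eb.
  move/gi; rewrite clamp_in in_itv /= ler01 lexx => /(_ isT isT).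
  have : h (clamp (2 * t - 1)) = h 0 by rewrite -e eb.
  move/hi; rewrite clamp_in in_itv /= ler01 lexx => /(_ isT isT).
  by rewrite !clamp_id ?in_itv /=; lra.
exists k; split.
- have cl (u v : R) (f : R -> R * R) : continuous f ->
      continuous (fun t => f (clamp (u * t - v))).
    move=> fc t.
    apply: (@continuous_comp _ _ _ (fun t => clamp (u * t - v)) f); last exact: fc.
    apply: (@continuous_comp _ _ _ (fun t : R => u * t - v) clamp).
      by apply: cvgB; [apply: cvgM; [exact: cvg_cst|exact: cvg_id]|exact: cvg_cst].
    exact: clamp_continuous.
  move=> t; apply: cvgB; last exact: cvg_cst.
  apply: cvgD; last exact: (cl 2 1 h hc t).
  by have := cl 2 0 g gc t; under eq_fun do rewrite subr0.
- move=> s t s01 t01.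
  have [s2|s2] := leP s (1 / 2); have [t2|t2] := leP t (1 / 2).
  + move: s01 t01; rewrite !in_itv /= => s01 t01.
    rewrite !kl // => /gi; rewrite !clamp_in => /(_ isT isT).
    by rewrite !clamp_id ?in_itv /=; lra.
  + by apply: mix => //; exact: ltW.
  + by move/esym => e; apply/esym; move: e; apply: mix => //; exact: ltW.
  + move: s01 t01; rewrite !in_itv /= => s01 t01.
    rewrite !kr ?ltW // => /hi; rewrite !clamp_in => /(_ isT isT).
    by rewrite !clamp_id ?in_itv /=; lra.
- by rewrite kl ?clamp_le0 //; lra.
- by rewrite kr ?clamp_ge1 //; lra.
- apply/seteqP; split => z.
    case=> -[t t01 <-].
      exists (t / 2).
        by move: t01; rewrite /= !in_itv /= => /andP[? ?]; apply/andP; split; lra.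
      rewrite kl; last by move: t01; rewrite /= !in_itv /= => /andP[? ?]; lra.
      by rewrite mulrC divfK // clamp_id.
    exists ((t + 1) / 2).
      by move: t01; rewrite /= !in_itv /= => /andP[? ?]; apply/andP; split; lra.
    rewrite kr; last by move: t01; rewrite /= !in_itv /= => /andP[? ?]; lra.
    by rewrite mulrC divfK // addrK clamp_id.
  case=> t t01 <-; have [t2|t2] := leP t (1 / 2).
    by left; rewrite kl //; exact: image_clamp.
  by right; rewrite kr ?ltW //; exact: image_clamp.
Qed.

Lemma arc_split A a b x : simple_arc A a b -> A x -> x <> a -> x <> b ->
  exists B C, [/\ simple_arc B a x, simple_arc C x b, A = B `|` C
    & forall z, B z -> C z -> z = x].
Proof.
case=> g [gc gi g0 g1 ->] [t t01 gt] xa xb.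
have t0 : t <> 0 by move=> e; apply: xa; rewrite -gt e.
have t1 : t <> 1 by move=> e; apply: xb; rewrite -gt e.
have /andP[lt0 lt1] : 0 < t < 1.
  move: t01; rewrite /= in_itv /= => /andP[? ?].
  by rewrite !lt_neqAle eq_sym; do ?[apply/andP; split => //]; exact/eqP.
exists (g @` `[0, t]), (g @` `[t, 1]); split.
- by rewrite -g0 -gt; apply: arc_sub => //; exact: ltW.
- by rewrite -g1 -gt; apply: arc_sub => //; exact: ltW.
- rewrite -image_setU; congr image; apply/seteqP; split => u /=.
    rewrite !in_itv /= => /andP[u0 u1].
    by have [ut|ut] := leP u t; [left|right]; rewrite ?u0 ?u1 ?(ltW ut).
  by rewrite !in_itv /=; case=> /andP[? ?]; apply/andP; split; lra.
- move=> z [u u0t <-] [v vt1 /gi].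
  move: u0t vt1; rewrite /= !in_itv /= => /andP[? ?] /andP[? ?] e.
  have vu : v = u by apply: e; apply/andP; split; lra.
  by rewrite -gt; congr g; lra.
Qed.

(* The part of the arc after its last visit to the unit ball. *)
Lemma arc_last_exit A b : simple_arc A 0 b -> 1 < `|b| ->
  exists d B, [/\ `|d| = 1, simple_arc B d b, B `<=` A
    & forall z, B z -> `|z| <= 1 -> z = d].
Proof.
case=> g [gc gi g0 g1 ->] b1.
(* The times spent in the closed unit ball form a compact set that contains [0]; its greatest
   element is the last visit. *)
pose K : set R := `[0, 1] `&` [set t | `|g t| <= 1].
have ngc : continuous (fun t => `|g t|).
  by move=> t; apply: continuous_comp; [exact: gc|exact: norm_continuous].
have K0 : K !=set0.
  by exists 0; split; rewrite /= ?in_itv /= ?lexx ?ler01 // g0 normr0 ler01.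
have Kc : compact K.
  apply: (@subclosed_compact _ _ `[0, 1 : R]); last by move=> t [].
    apply: closedI; first exact: itv_closed.
    apply: (@closed_comp _ _ _ [set x : R | x <= 1]); last exact: closed_le.
    by move=> t _; exact: ngc.
  exact: segment_compact.
have [|t] := @compact_EVT_max R R id K K0 Kc.
  by apply: continuous_subspaceT => t; exact: cvg_id.
rewrite inE => -[t01 tK] tm.
have {}tm s : s \in `[0, 1] -> `|g s| <= 1 -> s <= t.
  by move=> s01 sK; apply: tm; rewrite inE.
have t1 : t < 1.
  move: t01; rewrite /= in_itv /= => /andP[_]; rewrite le_eqVlt => /orP[/eqP e|//].
  by move: tK; rewrite /= e g1 leNgt b1.
have t0 : 0 <= t by move: t01; rewrite /= in_itv /= => /andP[].
exists (g t), (g @` `[t, 1]); split.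
(* If the norm were below one at the last visit, the intermediate value theorem would give a later
   time with norm one. *)
- apply/eqP; rewrite eq_le; apply/andP; split; first exact: tK.
  rewrite leNgt; apply/negP => lt1.
  have [||s] := @IVT R (fun t => `|g t|) t 1 1 (ltW t1).
  + by apply: continuous_subspaceT.
  + by rewrite g1 (min_idPl _) ?(max_idPr _) ?(ltW lt1) ?(ltW b1) //;
      apply: le_trans (ltW lt1) (ltW b1).
  rewrite in_itv /= => /andP[ts s1] gs.
  have st : s <= t.
    by apply: tm; rewrite ?gs ?in_itv /= ?s1 ?(le_trans t0).
  by have e : s = t by [lra]; move: lt1; rewrite -e gs ltxx.
- by rewrite -g1; apply: arc_sub.
- move=> z [s]; rewrite /= in_itv /= => /andP[? ?] <-; exists s => //=.
  by rewrite in_itv /=; apply/andP; split; lra.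
- move=> z [s]; rewrite /= in_itv /= => /andP[? ?] <- /tm st; congr g.
  by have : s <= t; [apply: st; rewrite in_itv /=; apply/andP; split; lra|lra].
Qed.

Lemma arc_homothety A a b c (k : R) : 0 < k -> simple_arc A a b ->
  simple_arc ((fun z => k *: (z - c)) @` A) (k *: (a - c)) (k *: (b - c)).
Proof.
move=> k0 [g [gc gi g0 g1 ->]]; exists (fun t => k *: (g t - c)); split.
- move=> t; apply: cvgZl_tmp; apply: cvgB; [exact: gc|exact: cvg_cst].
- move=> s t s01 t01 /(scalerI (lt0r_neq0 k0)) /addIr; exact: gi.
- by rewrite g0.
- by rewrite g1.
- by rewrite image_comp.
Qed.

End Arcs.

(** * Drawings of multigraphs *)

Section Drawings.
Variables (R : realType) (T : finType).
Implicit Types (p : T -> R * R) (e f : {set T} * set (R * R)).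
Implicit Types (D : seq ({set T} * set (R * R))) (M : seq {set T}).
Implicit Types (u w x y : T) (z d : R * R).

Definition good p e :=
  (exists x y, e.1 = [set x; y]%SET /\ simple_arc e.2 (p x) (p y)) /\
  (forall x, e.2 (p x) -> x \in e.1).

(** By [good], such a vertex is an end of both edges; parallel edges may thus share both ends. *)
Definition compat p e f := forall z, e.2 z -> f.2 z -> exists x, z = p x.

(** [pairwise] compares positions of the sequence, so parallel edges too need arcs that meet only in
    vertices. *)
Definition drawn p D :=
  (forall e, e \in D -> good p e) /\
  pairwise (fun e f => `[< compat p e f >]) D.

(* Unlike a graph, the sequence [M] may contain parallel edges. *)
Definition plan M := exists p D, [/\ injective p, map fst D = M & drawn p D].

Lemma compat_sym p e f : compat p e f -> compat p f e.
Proof. by move=> c z fz ez; exact: c. Qed.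

Lemma set2_inj x y x' y' : [set x; y]%SET = [set x'; y']%SET ->
  (x = x' /\ y = y') \/ (x = y' /\ y = x').
Proof.
move=> e; have := set21 x y; have := set22 x y; have := set21 x' y'.
have := set22 x' y'; rewrite -{1 2}e {3 4}e !inE.
do 4! [case/orP => /eqP ?]; subst; by [left|right].
Qed.

Lemma goodP p x y A : good p ([set x; y]%SET, A) <->
  simple_arc A (p x) (p y) /\ forall t, A (p t) -> t = x \/ t = y.
Proof.
split=> [[[x' [y' [/= /set2_inj exy Axy]]] AV]|[Axy AV]].
  split; last by move=> z /AV; rewrite !inE => /orP[] /eqP ->; [left|right].
  by case: exy => -[-> ->] //; exact: arc_sym.
split; first by exists x, y.
by move=> z /AV /= [] ->; rewrite !inE eqxx ?orbT.
Qed.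

Lemma good_at p e w : good p e -> w \in e.1 ->
  exists x, e.1 = [set w; x]%SET /\ simple_arc e.2 (p w) (p x).
Proof.
case=> -[x [y [-> Axy]]] _; rewrite !inE => /orP[] /eqP ->.
  by exists y.
by exists x; split; [exact: finset.setUC|exact: arc_sym].
Qed.

Lemma drawn_cons p e D : drawn p (e :: D) <->
  [/\ good p e, forall f, f \in D -> compat p e f & drawn p D].
Proof.
split.
  case=> gD /= /andP[/allP cD pD]; split.
  - by apply: gD; rewrite mem_head.
  - by move=> f /cD /asboolP.
  - by split => // f fD; apply: gD; rewrite in_cons fD orbT.
case=> ge cD [gD pD]; split.
  by move=> f; rewrite in_cons => /orP[/eqP -> //|]; exact: gD.
by rewrite /= pD andbT; apply/allP => f /cD ?; exact/asboolP.
Qed.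

Lemma drawn_catCA p D1 D2 D3 : drawn p (D1 ++ D2 ++ D3) -> drawn p (D2 ++ D1 ++ D3).
Proof.
case=> gD pD; split.
  by move=> e eD; apply: gD; move: eD; rewrite !mem_cat orbCA.
move: pD; rewrite !pairwise_cat !allrel_catr.
case/and3P => /andP[c12 c13] p1 /and3P[c23 p2 p3].
rewrite c13 c23 p1 p2 p3 !andbT /=.
apply/allrelP => e f e2 f1; apply/asboolP/compat_sym/asboolP.
by move/allrelP: c12; apply.
Qed.

Lemma drawn_map p q (h : {set T} * set (R * R) -> {set T} * set (R * R)) D :
  drawn p D -> (forall e, e \in D -> good p e -> good q (h e)) ->
  (forall e f, e \in D -> f \in D -> good p e -> good p f ->
    compat p e f -> compat q (h e) (h f)) ->
  drawn q (map h D).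
Proof.
elim: D => [|e D IH] // /drawn_cons[ge cD dD] gh ch; apply/drawn_cons; split.
- by apply: gh; rewrite ?mem_head.
- move=> _ /mapP[f fD ->]; case: (dD) => gD _; apply: ch; rewrite ?mem_head //.
  + by rewrite in_cons fD orbT.
  + exact: gD.
  + exact: cD.
- by apply: IH => // [f fD|f f' fD fD']; [apply: gh|apply: ch];
    rewrite in_cons ?fD ?fD' orbT.
Qed.

Lemma plan_perm M N : perm_eq M N -> plan M -> plan N.
Proof.
move=> MN; move: M N MN; apply: catCA_perm_ind => M1 M2 M3 [p [D [pi DM dD]]].
pose D1 := take (size M1) D.
pose D2 := take (size M2) (drop (size M1) D).
pose D3 := drop (size M2) (drop (size M1) D).
exists p, (D2 ++ D1 ++ D3); split => //.
  rewrite !map_cat !(map_take, map_drop) DM.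
  by rewrite drop_size_cat // !take_size_cat // drop_size_cat.
by apply: drawn_catCA; rewrite /D1 /D2 /D3 !cat_take_drop.
Qed.

Lemma plan_behead s M : plan (s :: M) -> plan M.
Proof.
case=> p [[|e D] [pi // [_ DM] /drawn_cons[_ _ dD]]].
by exists p, D.
Qed.

Lemma plan_subseq M N : subseq M N -> plan N -> plan M.
Proof.
move=> /perm_to_subseq[S MN]; have NM : perm_eq N (S ++ M).
  by rewrite (perm_trans MN) // perm_catC.
move/(plan_perm NM); elim: S {MN NM} => //= s S IH /plan_behead; exact: IH.
Qed.

Lemma plan_card2 M s : plan M -> s \in M -> #|s| = 2%N.
Proof.
case=> p [D [pi <- [gD _]]] /mapP[e eD ->]; have [[x [y [-> /arc_neq xy]]] _] := gD _ eD.
by rewrite cards2 (_ : x != y) //; apply/eqP => exy; apply: xy; rewrite exy.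
Qed.

(** The arcs stay where they are; only the names of the vertices change. *)
Lemma plan_rename (s : {perm T}) M : plan M -> plan [seq (s @: i)%SET | i : {set T} <- M].
Proof.
case=> p [D [pi <- dD]].
exists (fun x => p ((s^-1)%g x)), (map (fun e => ((s @: e.1)%SET, e.2)) D); split.
- exact: inj_comp pi perm_inj.
- by rewrite -!map_comp.
- apply: (drawn_map dD) => [e eD [[x [y [exy Axy]]] eV]|e f _ _ _ _ c z ez fz].
    split=> /=; first by exists (s x), (s y); rewrite !permK exy imsetU1 imset_set1.
    by move=> t /eV te; apply/imsetP; eexists; [exact: te|rewrite permKV].
  by have [x ->] := c z ez fz; exists (s x); rewrite permK.
Qed.

(** The minimum of finitely many positive bounds serves for all items, since a bound may be
    decreased. *)
Lemma fin_pos (X : eqType) (s : seq X) (Q : X -> R -> Prop) :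
  (forall i r r', Q i r -> r' <= r -> Q i r') ->
  (forall i, i \in s -> exists2 r, 0 < r & Q i r) ->
  exists2 r, 0 < r & forall i, i \in s -> Q i r.
Proof.
move=> Qm; elim: s => [|i s IH] Qs; first by exists 1.
have [r r0 Qr] := Qs i (mem_head _ _).
have [|r' r'0 Qr'] := IH.
  by move=> j js; apply: Qs; rewrite in_cons js orbT.
exists (Num.min r r'); first by rewrite lt_min r0.
move=> j; rewrite in_cons => /orP[/eqP ->|js].
  by apply: Qm Qr _; rewrite ge_min lexx.
by apply: Qm (Qr' _ js) _; rewrite ge_min lexx orbT.
Qed.

Lemma small_pos (s : seq R) :
  exists2 r, 0 < r <= 1 & forall i : R, i \in s -> 0 < i -> r < i.
Proof.
have [|i|r r0 rs] := @fin_pos R s (fun i r => 0 < i -> r < i).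
- by move=> i r r' ir rr /ir; exact: le_lt_trans.
- have [i0 _|i0 _] := ltP 0 i; last by exists 1 => //; rewrite ltNge i0.
  by exists (i / 2) => *; lra.
- exists (Num.min r 1); first by rewrite lt_min r0 ltr01 ge_min lexx orbT.
  by move=> i si /(rs _ si); apply: le_lt_trans; rewrite ge_min lexx.
Qed.

(** The norm on [R * R] is the maximum norm, so discs are squares here. *)
Lemma norm_pair (a b : R) : `|(a, b)| = Num.max `|a| `|b|.
Proof. by rewrite prod_normE. Qed.

Lemma drawn_far p D : drawn p D -> exists z,
  (forall x, p x <> z) /\ (forall e, e \in D -> ~ e.2 z).
Proof.
move=> [gD _].
have [||r r0 rp] := @fin_pos T (enum T) (fun x r => `|p x| * r <= 1).
- by move=> x r r' xr rr; apply: le_trans xr; apply: ler_wpM2l.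
- move=> x _; exists (`|p x| + 1)^-1; first by rewrite invr_gt0 ltr_wpDl.
  by rewrite ler_pdivrMr ?ltr_wpDl // mul1r lerDl.
have [||r' r'0 rD] := @fin_pos _ D (fun e r => forall z, e.2 z -> `|z| * r <= 1).
- by move=> e s s' xr rr z /xr; apply: le_trans; apply: ler_wpM2l.
- move=> e /gD [[x [y [_ /arc_bounded[m Am]]]] _]; exists (`|m| + 1)^-1.
    by rewrite invr_gt0 ltr_wpDl.
  move=> z /Am zm; rewrite ler_pdivrMr ?ltr_wpDl // mul1r.
  by apply: le_trans zm _; apply: le_trans (ler_norm _) _; rewrite lerDl.
(* [r^-1] bounds the norms of the vertices and [r'^-1] those of the points on arcs; the sum exceeds
   both. *)
pose k := r^-1 + r'^-1; have k0 : 0 < k by rewrite addr_gt0 ?invr_gt0.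
have kn : `|(k, 0) : R * R| = k.
  by rewrite norm_pair normr0 gtr0_norm // (max_idPl _) // ltW.
have rr : r^-1 * r = 1 by rewrite mulVf // lt0r_neq0.
have rr' : r'^-1 * r' = 1 by rewrite mulVf // lt0r_neq0.
have ri : 0 < r^-1 by rewrite invr_gt0.
have ri' : 0 < r'^-1 by rewrite invr_gt0.
exists (k, 0); split.
  by move=> x px; have := rp x (mem_enum _ x); rewrite px kn /k; nra.
by move=> e eD /(rD _ eD); rewrite kn /k; nra.
Qed.

(** * Moving an isolated vertex; subdividing and suppressing edges *)

Definition put p u z x := if x == u then z else p x.

Lemma put_eq p u z : put p u z u = z.
Proof. by rewrite /put eqxx. Qed.

Lemma put_neq p u z x : x != u -> put p u z x = p x.
Proof. by rewrite /put => /negbTE ->. Qed.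

Lemma put_inj p u z : injective p -> (forall x, x != u -> p x <> z) ->
  injective (put p u z).
Proof.
move=> pi pz x y; rewrite /put; case: eqVneq => [->|xu]; case: eqVneq => [->|yu] //.
- by move/esym/pz => /(_ yu).
- by move/pz => /(_ xu).
- exact: pi.
Qed.

(** A common point of the two arcs is an end of [e], hence not [u]; so only one of the two edges has
    to avoid [u]. *)
Lemma compat_put p u z e f : good p e -> u \notin e.1 ->
  compat p e f -> compat (put p u z) e f.
Proof.
move=> [_ eV] ue c z' ez fz; have [x zx] := c z' ez fz.
exists x; rewrite put_neq //; apply: contraNneq ue => <-; apply: eV.
by rewrite -zx.
Qed.

Lemma drawn_put p u z D : drawn p D -> (forall e, e \in D -> u \notin e.1) ->
  (forall e, e \in D -> ~ e.2 z) -> drawn (put p u z) D.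
Proof.
move=> dD uD zD; rewrite -[D]map_id; apply: (drawn_map dD).
  move=> e eD [[x [y [exy Axy]]] eV]; have := uD _ eD.
  rewrite exy !inE negb_or eq_sym [u == y]eq_sym => /andP[xu yu]; split.
    by exists x, y; rewrite !put_neq.
  move=> t; rewrite /put; case: eqVneq => [_ /(zD _ eD)//|_]; exact: eV.
by move=> e f eD fD ge gf; apply: compat_put; [exact: ge|exact: uD].
Qed.

Definition isolated M u := forall s, s \in M -> u \notin s.

Lemma drawn_iso D u : isolated (map fst D) u -> forall e, e \in D -> u \notin e.1.
Proof. by move=> uD e eD; apply: uD; exact: map_f. Qed.

(** The vertex [u] is moved to the inner point [z] of [A]. No other arc passes through [z], since it
    can share only vertices with [A], and these are the ends of [A]. *)
Lemma drawn_subdivide p D x y u z A :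
  injective p -> drawn p (([set x; y]%SET, A) :: D) -> isolated (map fst D) u ->
  u != x -> u != y -> A z -> z <> p x -> z <> p y ->
  exists B C, [/\ A = B `|` C, injective (put p u z)
    & drawn (put p u z) (([set x; u]%SET, B) :: ([set u; y]%SET, C) :: D)].
Proof.
move=> pi /drawn_cons[/goodP[Axy AV] cA dD] uD ux uy Az zx zy.
have [B [C [arcB arcC AE BC]]] := arc_split Axy Az zx zy.
have /drawn_iso {}uD := uD; have [gD _] := dD.
have zD f : f \in D -> ~ f.2 z.
  move=> fD fz; have [t zt] := cA f fD z Az fz.
  by move: Az zx zy; rewrite zt => /AV[] ->.
have px : put p u z x = p x by rewrite put_neq // eq_sym.
have py : put p u z y = p y by rewrite put_neq // eq_sym.
have zp t : p t <> z.
  by move=> zt; move: Az zx zy; rewrite -zt => /AV[] ->.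
have dmv := drawn_put dD uD zD.
exists B, C; split => //; first exact: put_inj.
apply/drawn_cons; split; last (apply/drawn_cons; split => //).
- apply/goodP; rewrite px put_eq; split => // t.
  rewrite /put; case: eqVneq => [->|_ Bt]; first by right.
  have [->|ty] : t = x \/ t = y by apply: AV; rewrite AE; left.
    by left.
  by case: zy; apply/esym/BC; [rewrite -ty|exact: arc_r arcC].
- move=> f; rewrite in_cons => /orP[/eqP ->|fD].
    by move=> t /= Bt Ct; exists u; rewrite put_eq; exact: BC.
  apply/compat_sym/compat_put; [exact: gD|exact: uD|].
  by move=> t ft Bt; apply: (cA f fD) => //; rewrite /= AE; left.
- apply/goodP; rewrite py put_eq; split => // t.
  rewrite /put; case: eqVneq => [->|_ Ct]; first by left.
  have [tx|->] : t = x \/ t = y by apply: AV; rewrite AE; right.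
    by case: zx; apply/esym/BC; [exact: arc_l arcB|rewrite -tx].
  by right.
- move=> f fD; apply/compat_sym/compat_put; [exact: gD|exact: uD|].
  by move=> t ft Ct; apply: (cA f fD) => //; rewrite /= AE; right.
Qed.

Lemma plan_subdivide x y u M : isolated M u -> u != x -> u != y ->
  plan ([set x; y]%SET :: M) -> plan ([set x; u]%SET :: [set u; y]%SET :: M).
Proof.
move=> uM ux uy [p [[|[s A] D] [pi // [/= -> DM] dD]]].
have /drawn_cons[/goodP[Axy _] _ _] := dD.
have [z [Az zx zy]] : exists z, [/\ A z, z <> p x & z <> p y].
  case: Axy => g [_ gi <- <- ->]; exists (g (1 / 2)); split.
  - by exists (1 / 2) => //=; rewrite in_itv /=; lra.
  - by move/gi; rewrite !in_itv /=; lra.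
  - by move/gi; rewrite !in_itv /=; lra.
rewrite -DM in uM *.
have [B [C [_ mi dD']]] := drawn_subdivide pi dD uM ux uy Az zx zy.
by eexists; eexists; split; [exact: mi| |exact: dD'].
Qed.

(** The two arcs at [u] are joined. As [u] would then lie inside an arc, it is moved to a point far
    away. *)
Lemma plan_suppress x y u M : isolated M u -> x != y ->
  plan ([set x; u]%SET :: [set u; y]%SET :: M) -> plan ([set x; y]%SET :: M).
Proof.
move=> uM xy [p [[|[s A] [|[s' B] D]] [pi // [-> -> DM] dABD]]].
have [z [zp zD]] := drawn_far dABD.
move: dABD => /drawn_cons[/goodP[Axu AV] cA].
move=> /drawn_cons[/goodP[Buy BV] cB dD].
rewrite -DM in uM *; have /drawn_iso {}uM := uM.
have ux : u != x by apply/eqP => e; move/arc_neq: Axu; rewrite e.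
have uy : u != y by apply/eqP => e; move/arc_neq: Buy; rewrite e.
(* A common point is a vertex that ends both arcs, and [x] differs from [y]. *)
have ABu t : A t -> B t -> t = p u.
  move=> At Bt; have [v tv] := cA _ (mem_head _ _) t At Bt.
  by move: At Bt xy; rewrite tv => /AV[] -> // /BV[] -> //; rewrite eqxx.
have [gD _] := dD.
exists (put p u z), (([set x; y]%SET, A `|` B) :: D); split => //.
  by apply: put_inj => // t _; exact: zp.
apply/drawn_cons; split.
- apply/goodP; rewrite !put_neq 1?eq_sym //; split; first exact: arc_cat Buy ABu.
  move=> t; rewrite /put; case: eqVneq => [_|tu].
    case=> [Az|Bz].
      by case: (zD ([set x; u]%SET, A)); rewrite ?mem_head.
    by case: (zD ([set u; y]%SET, B)); rewrite ?in_cons ?eqxx ?orbT.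
  case=> [/AV|/BV] [] tE; [by left| | |by right];
    by move: tu; rewrite tE eqxx.
- move=> f fD; apply/compat_sym/compat_put; [exact: gD|exact: uM|].
  move=> t ft [At|Bt]; last by apply: (cB f).
  by apply: (cA f) => //; rewrite in_cons fD orbT.
- apply: drawn_put => // e eD; apply: zD.
  by rewrite !in_cons eD !orbT.
Qed.

(** * Straightening a drawing near a vertex and drawing new edges there *)

Lemma drawn_homothety p D (k : R) c : 0 < k -> drawn p D ->
  drawn (fun x => k *: (p x - c))
    (map (fun e => (e.1, (fun z => k *: (z - c)) @` e.2)) D).
Proof.
move=> k0 dD; have hi : injective (fun z : R * R => k *: (z - c)).
  by move=> z z' /(scalerI (lt0r_neq0 k0)) /addIr.
apply: (drawn_map dD) => [e eD [[x [y [exy Axy]]] eV]|e f _ _ _ _ ef _ [z ez <-] [z' fz /hi zz]].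
  split; first by exists x, y; split => //; exact: arc_homothety.
  by move=> t [z ez /hi zt]; apply: eV; rewrite -zt.
by have [|x ->] := ef z ez; [rewrite -zz|exists x].
Qed.

Lemma segP z d : seg 0 d z <-> exists2 t : R, 0 <= t <= 1 & z = t *: d.
Proof.
by split=> -[t t01 ->]; exists t; rewrite // subr0 add0r.
Qed.

(** Both coefficients are the norm of the common point. *)
Lemma ray_inj (t t' : R) d d' : 0 <= t -> 0 <= t' -> `|d| = 1 -> `|d'| = 1 ->
  t *: d = t' *: d' -> t = 0 \/ d = d'.
Proof.
move=> t0 t'0 d1 d'1 e; have : `|t *: d| = `|t' *: d'| by rewrite e.
rewrite !normrZ d1 d'1 !mulr1 !ger0_norm // => tt.
have [->|tn0] := eqVneq t 0; first by left.
by right; apply: (scalerI tn0); rewrite e tt.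
Qed.

Definition star p w (dir : {set T} * set (R * R) -> R * R) D :=
  [/\ p w = 0, forall x, x != w -> 1 < `|p x|,
    forall e, e \in D -> w \notin e.1 -> forall z, e.2 z -> 1 < `|z| &
    forall e, e \in D -> w \in e.1 -> [/\ `|dir e| = 1,
      forall z, e.2 z -> `|z| <= 1 -> seg 0 (dir e) z &
      forall z, seg 0 (dir e) z -> e.2 z]].

(* Inside the disc the new drawing keeps only the radius to the point of last
   exit of every arc at [w]. *)
Lemma drawn_straighten p D w : injective p -> drawn p D -> p w = 0 ->
  (forall x, x != w -> 1 < `|p x|) ->
  (forall e, e \in D -> w \notin e.1 -> forall z, e.2 z -> 1 < `|z|) ->
  exists D' dir, [/\ map fst D' = map fst D, drawn p D' & star p w dir D'].
Proof.
move=> pi dD pw0 p1 D1.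
(* [q] consists of the point of last exit and the new arc: the radius to this point followed by the
   rest of the old arc. *)
pose Q (e : {set T} * set (R * R)) (q : (R * R) * set (R * R)) :=
  e \in D -> w \in e.1 -> [/\ `|q.1| = 1 /\ e.2 q.1,
    exists x, e.1 = [set w; x]%SET /\ simple_arc q.2 0 (p x),
    forall z, q.2 z -> `|z| <= 1 -> seg 0 q.1 z,
    forall z, seg 0 q.1 z -> q.2 z & forall z, q.2 z -> 1 < `|z| -> e.2 z].
have [|q Qq] := @choice _ _ Q.
  move=> e; have [eD|neD] := boolP (e \in D); last by exists (0, set0); rewrite /Q (negbTE neD).
  have [we|nwe] := boolP (w \in e.1); last by exists (0, set0); rewrite /Q (negbTE nwe).
  have ge : good p e by case: dD => gD _; exact: gD.
  have [x [ex Ax]] := good_at ge we.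
  have xw : x != w.
    by apply/eqP => xw; move/arc_neq: Ax; rewrite xw.
  rewrite pw0 in Ax; have [d [B [d1 Bd BA Bd1]]] := arc_last_exit Ax (p1 _ xw).
  have seg1 z : seg 0 d z -> `|z| <= 1.
    by move=> /segP[t /andP[t0 t1] ->]; rewrite normrZ d1 mulr1 ger0_norm.
  exists (d, seg 0 d `|` B) => _ _; split => /=.
  - by split => //; apply: BA; exact: arc_l Bd.
  - exists x; split => //; apply: (arc_cat _ Bd).
      by apply: arc_seg => d0; move: d1; rewrite -d0 normr0 => /eqP; rewrite eq_sym oner_eq0.
    by move=> z /seg1 z1 Bz; exact: Bd1.
  - move=> z [//|Bz z1]; rewrite (Bd1 z) //.
    by apply/segP; exists 1; rewrite ?ler01 ?lexx ?scale1r.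
  - by move=> z; left.
  - by move=> z [/seg1|/BA //]; rewrite leNgt => /negbTE ->.
pose h e := (e.1, if w \in e.1 then (q e).2 else e.2).
have h1 e z : e \in D -> (h e).2 z -> 1 < `|z| -> e.2 z.
  rewrite /h /=; case: ifP => // we eD; have [_ _ _ _] := Qq e eD we; exact.
(* The direction has to be a function of the new edge, so a preimage under [h] is picked. Any
   preimage serves, since [star] speaks only of the new arc. *)
exists (map h D), (fun e => if [pick i : 'I_(size D) | h (nth e D i) == e] is Some i
  then (q (nth e D i)).1 else 0); split.
- by rewrite -map_comp; exact: eq_map.
- apply: (drawn_map dD) => [e eD ge|e f eD fD ge gf ef].
    split.
      rewrite /h /=; case: ifP => we; last by case: ge.
      have [_ [x [-> qx]] _ _ _] := Qq e eD we.
      by exists w, x; rewrite pw0.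
    move=> x hx; have [xw|/p1 px] := eqVneq x w; last by case: ge => _; apply; exact: h1.
    rewrite /h /= xw; apply: contraT => nwe.
    by move: hx; rewrite /h /= (negbTE nwe) xw; case: ge => _ /[apply]; rewrite (negbTE nwe).
  move=> z hez hfz; have [z1|z1] := ltP 1 `|z|; first by apply: ef; exact: h1.
  move: hez hfz; rewrite /h /=; case: ifP => we; last first.
    by move=> /(D1 _ eD) -/(_ (negbT we)); rewrite ltNge z1.
  case: ifP => wf; last first.
    by move=> _ /(D1 _ fD) -/(_ (negbT wf)); rewrite ltNge z1.
  have [[qe1 eqe] _ qel _ _] := Qq e eD we.
  have [[qf1 fqf] _ qfl _ _] := Qq f fD wf.
  move=> /qel -/(_ z1) /segP[t /andP[t0 _] zt] /qfl -/(_ z1) /segP[t' /andP[t'0 _] zt'].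
  (* Radii that meet off the centre have equal directions. The old arcs then share a point of norm
     one, hence a vertex, but no vertex has norm one. *)
  have [tz|qq] := ray_inj t0 t'0 qe1 qf1 (etrans (esym zt) zt').
    by exists w; rewrite zt tz scale0r pw0.
  have [|x px] := ef _ eqe; first by rewrite qq.
  have [xw|/p1] := eqVneq x w; last by rewrite -px qe1 ltxx.
  by move/eqP: qe1; rewrite px xw pw0 normr0 eq_sym oner_eq0.
- split => //.
    move=> _ /mapP[e eD ->] nwe; rewrite /h /= (negbTE nwe) => z; exact: D1.
  move=> _ /mapP[e eD ->]; rewrite /= => we.
  case: pickP => [i /eqP hi|]; last first.
    have ie : (index e D < size D)%N by rewrite index_mem.
    by move=> /(_ (Ordinal ie)) /=; rewrite nth_index // eqxx.
  set f := nth _ _ _ in hi *; have fD : f \in D by rewrite mem_nth.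
  have wf : w \in f.1 by have := congr1 fst hi; rewrite /h /= => ->.
  have := congr1 snd hi; rewrite /h /= wf we => <-.
  by have [[? _] _ ? ? _] := Qq f fD wf.
Qed.

Lemma drawn_star p D w : injective p -> drawn p D ->
  exists p' D' dir, [/\ injective p', map fst D' = map fst D, drawn p' D'
    & star p' w dir D'].
Proof.
move=> pi dD; have [gD _] := dD.
have [||r r0 rp] := @fin_pos T (enum T) (fun x r => x != w -> r <= `|p x - p w|).
- by move=> x r r' xr rr /xr; apply: le_trans.
- move=> x _; have [->|xw] := eqVneq x w; first by exists 1.
  exists `|p x - p w| => //; rewrite normr_gt0 subr_eq0.
  by apply: contra_neq xw; exact: pi.
have [||r' r'0 rD] := @fin_pos _ D
    (fun e r => w \notin e.1 -> forall z, e.2 z -> r <= `|z - p w|).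
- by move=> e s s' er rr we z /(er we); apply: le_trans.
- move=> e /gD [[x [y [_ Axy]]] eV]; have [we|nwe] := boolP (w \in e.1); first by exists 1.
  have [|s s0 se] := arc_away (c := p w) Axy.
    by move=> /eV; rewrite (negbTE nwe).
  by exists s => // _.
(* This makes [k * r] and [k * r'] exceed one, so the other vertices and the arcs that avoid [w]
   leave the closed unit disc. *)
pose k := 2 * (r^-1 + r'^-1).
have ri : 0 < r^-1 by rewrite invr_gt0.
have ri' : 0 < r'^-1 by rewrite invr_gt0.
have rr : r^-1 * r = 1 by rewrite mulVf // lt0r_neq0.
have rr' : r'^-1 * r' = 1 by rewrite mulVf // lt0r_neq0.
have k0 : 0 < k by rewrite /k; lra.
have kpi : injective (fun x => k *: (p x - p w)).
  by move=> x y /(scalerI (lt0r_neq0 k0)) /addIr /pi.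
have [|||D' [dir [DD dD' sD']]] := drawn_straighten kpi (drawn_homothety (p w) k0 dD) (w := w).
- by rewrite subrr scaler0.
- move=> x xw; have := rp x (mem_enum _ x) xw.
  by rewrite normrZ gtr0_norm // /k; nra.
- move=> _ /mapP[e eD ->] /= we _ [z ez <-].
  have := rD e eD we z ez.
  by rewrite normrZ gtr0_norm // /k; nra.
exists (fun x => k *: (p x - p w)), D', dir; split => //.
by rewrite DD -map_comp.
Qed.

(* The arc has one corner [c], off the ray of [d] by a slope smaller than that of
   all the rays of [ds], so no ray of [ds] enters the triangle [0], [c], [d / 2]. *)
Lemma bypass d (ds : seq (R * R)) : `|d| = 1 ->
  (forall d', d' \in ds -> `|d'| = 1) ->
  exists Q, [/\ simple_arc Q (2^-1 *: d) 0, forall z, Q z -> `|z| < 1,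
    forall z, Q z -> seg 0 d z -> z = 0 \/ z = 2^-1 *: d
    & forall z d', Q z -> d' \in ds -> d' != d -> seg 0 d' z -> z = 0].
Proof.
move=> d1 ds1.
(* Inner and cross product with [d]: the coordinates along [d] and along its normal, up to the
   factor [N]. The squared Euclidean length [N] need not be one, because [d] is a unit vector for
   the maximum norm. *)
pose a (z : R * R) := z.1 * d.1 + z.2 * d.2.
pose b (z : R * R) := z.2 * d.1 - z.1 * d.2.
pose N := d.1 ^+ 2 + d.2 ^+ 2.
have N0 : 0 < N.
  have [d0|/negP d0] := boolP ((d.1 == 0) && (d.2 == 0)).
    move: d1; rewrite (surjective_pairing d) norm_pair.
    case/andP: d0 => /eqP -> /eqP ->; rewrite normr0 maxxx => /eqP.
    by rewrite eq_sym oner_eq0.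
  have := sqr_ge0 d.1; have := sqr_ge0 d.2; rewrite /N => ? ?.
  rewrite lt_neqAle eq_sym addr_ge0 // andbT paddr_eq0 //.
  by rewrite !sqrf_eq0; exact/negP.
have [s /andP[s0 s1] sds] := small_pos [seq b d' / a d' | d' <- ds].
pose n : R * R := (- d.2, d.1).
have an (x y : R) : a (x *: d + y *: n) = x * N.
  by rewrite /a /N /= /GRing.scale /=; ring.
have bn (x y : R) : b (x *: d + y *: n) = y * N.
  by rewrite /b /N /= /GRing.scale /=; ring.
have n1 : `|n| = 1.
  by rewrite /n norm_pair normrN maxC -norm_pair -surjective_pairing.
have wn (x y : R) : 0 <= x -> 0 <= y -> `|x *: d + y *: n| <= x + y.
  move=> x0 y0; apply: le_trans (ler_normD _ _) _.
  by rewrite !normrZ d1 n1 !mulr1 !ger0_norm.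
pose c := 4^-1 *: d + (s / 4) *: n.
have seg_dc (t : R) : 2^-1 *: d + t *: (c - 2^-1 *: d) =
    (2^-1 - t / 4) *: d + (t * (s / 4)) *: n.
  by apply: injective_projections; rewrite /c /n /= /GRing.scale /=; field.
have seg_c0 (t : R) : c + t *: (0 - c) =
    ((1 - t) / 4) *: d + ((1 - t) * (s / 4)) *: n.
  by apply: injective_projections; rewrite /c /n /= /GRing.scale /=; field.
(* A superset of the arc in these coordinates: the slope is at most [s], and the height vanishes
   only at the two ends. *)
pose L := [set z | exists2 xy : R * R, [/\ 0 <= xy.1, xy.1 <= 1 / 2, 0 <= xy.2,
  xy.2 <= s * xy.1 /\ (xy.2 = 0 -> xy.1 = 0 \/ xy.1 = 1 / 2) & xy.1 + xy.2 <= 1 / 2]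
   & z = xy.1 *: d + xy.2 *: n].
have QL z : (seg (2^-1 *: d) c `|` seg c 0) z -> L z.
  case=> -[t /andP[t0 t1] ->].
    exists (2^-1 - t / 4, t * (s / 4)) => /=.
      split; [nra|nra|nra|split; first nra|nra].
      move=> e; have : t = 0 by nra.
      by move=> ->; right; lra.
    exact: seg_dc.
  exists ((1 - t) / 4, (1 - t) * (s / 4)) => /=.
    split; [nra|nra|nra|split; first nra|nra].
    move=> e; have : t = 1 by nra.
    by move=> ->; left; lra.
  exact: seg_c0.
have bc : b c = s / 4 * N by rewrite bn.
have b0 : b 0 = 0 by rewrite /b /=; ring.
have bd (x : R) : b (x *: d) = 0 by rewrite /b /= /GRing.scale /=; ring.
have dc : 2^-1 *: d <> c by move/(congr1 b); rewrite bd bc; nra.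
have c0 : c <> 0 by move/(congr1 b); rewrite bc b0; nra.
exists (seg (2^-1 *: d) c `|` seg c 0); split.
- apply: (arc_cat (arc_seg dc) (arc_seg c0)).
  move=> z [t /andP[t0 t1] zt] [t' /andP[t'0 t'1] zt'].
  have e1 := etrans zt (seg_dc t); have e2 := etrans zt' (seg_c0 t').
  have ea : (2^-1 - t / 4) * N = (1 - t') / 4 * N by rewrite -(an _ (t * (s / 4))) -e1 e2 an.
  have eb : (t * (s / 4)) * N = (1 - t') * (s / 4) * N by rewrite -(bn (2^-1 - t / 4)) -e1 e2 bn.
  have {}ea : 2^-1 - t / 4 = (1 - t') / 4 by apply: (mulIf (lt0r_neq0 N0)).
  have {}eb : t * (s / 4) = (1 - t') * (s / 4) by apply: (mulIf (lt0r_neq0 N0)).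
  have t'E : t' = 0 by nra.
  by rewrite zt' t'E scale0r addr0.
- move=> z /QL[[x y] /= [x0 x1 y0 _ xy] ->].
  by apply: le_lt_trans (wn _ _ x0 y0) _; lra.
- move=> z /QL[[x y] /= [x0 x1 y0 [_ xy] _] ->] /segP[t t01 e].
  have y00 : y = 0.
    apply: (mulIf (lt0r_neq0 N0)); rewrite mul0r.
    by rewrite -(bn x) e bd.
  by case: (xy y00) => ->; [left|right]; rewrite y00 ?scale0r ?addr0 ?div1r.
- move=> z d' /QL[[x y] /= [x0 x1 y0 [ys xy] _] zE'] d'ds d'd /segP[t /andP[t0 t1] zt].
  have [tE|tn0] := eqVneq t 0; first by rewrite zt tE scale0r.
  have {tn0}tp : 0 < t by rewrite lt_neqAle eq_sym tn0.
  have aE : t * a d' = x * N by rewrite -(an x y) -zE' zt /a /= /GRing.scale /=; ring.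
  have bE : t * b d' = y * N by rewrite -(bn x y) -zE' zt /b /= /GRing.scale /=; ring.
  (* Otherwise the slope [b d' / a d'] of the common point would be at most [s], against the choice
     of [s]. *)
  have b'0 : b d' <= 0.
    rewrite leNgt; apply/negP => b'p.
    have ba : b d' <= s * a d' by rewrite -(ler_pM2l tp); nra.
    have a'p : 0 < a d' by rewrite -(pmulr_rgt0 _ s0); lra.
    have := sds (b d' / a d') (map_f _ d'ds); rewrite divr_gt0 // => /(_ isT).
    by rewrite ltr_pdivlMr //; nra.
  have y00 : y = 0 by nra.
  case: (xy y00) => xE; first by rewrite zE' xE y00 !scale0r addr0.
  have e : x *: d = t *: d' by rewrite -zt zE' y00 scale0r addr0.
  have [x00|dd] := ray_inj x0 t0 d1 (ds1 _ d'ds) e.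
    by rewrite zE' x00 y00 !scale0r addr0.
  by rewrite dd eqxx in d'd.
Qed.

(** Within the open unit disc the old drawing consists of radii only, so a new arc that stays inside
    has to be checked against these alone. *)
Lemma drawn_inner p D dir w u z X : star p w dir D -> drawn p D -> u != w ->
  simple_arc X z 0 -> (forall v, X v -> `|v| < 1) ->
  (forall v e, X v -> e \in D -> w \in e.1 -> seg 0 (dir e) v -> v = 0) ->
  good (put p u z) ([set u; w]%SET, X) /\
  forall e, e \in D -> compat (put p u z) ([set u; w]%SET, X) e.
Proof.
move=> [pw p1 D1 Dw] dD uw Xz X1 Xw.
have pw' : put p u z w = 0 by rewrite put_neq // eq_sym.
split.
  apply/goodP; rewrite put_eq pw'; split => // t.
  rewrite /put; case: eqVneq => [->|_ /X1 t1]; first by left.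
  right; apply/eqP; apply: contraTT t1 => /p1.
  by rewrite -leNgt; exact: ltW.
move=> e eD v /= Xv ev; exists w; rewrite pw'.
have [we|nwe] := boolP (w \in e.1).
  apply: (Xw v e) => //; have [_ es _] := Dw e eD we.
  by apply: es => //; apply/ltW/X1.
by have := D1 e eD nwe v ev; rewrite ltNge ltW // X1.
Qed.

Lemma norm_half d : `|d| = 1 -> `|2^-1 *: d| = 2^-1.
Proof. by move=> d1; rewrite normrZ d1 mulr1 gtr0_norm. Qed.

Lemma half_neq0 d : `|d| = 1 -> 2^-1 *: d <> 0.
Proof. by move/norm_half => + d0; rewrite d0 normr0; lra. Qed.

Lemma plan_double_pendant u w M : isolated M u -> u != w -> plan M ->
  plan ([set u; w]%SET :: [set u; w]%SET :: M).
Proof.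
move=> uM uw [p0 [D0 [pi0 DM0 dD0]]].
have [p [D [dir [pi DD dD sD]]]] := drawn_star w pi0 dD0.
rewrite -{}DM0 -{}DD {p0 D0 pi0 dD0} in uM *; have uD := drawn_iso uM.
have [pw p1 D1 Dw] := sD.
have [r /andP[r0 r1] rs] := small_pos [seq (dir e).2 | e <- D].
(* Being smaller than every positive second coordinate, [r] makes [d] differ from all directions in
   use. *)
pose d : R * R := (1, r).
have d1 : `|d| = 1 by rewrite norm_pair normr1 gtr0_norm // (max_idPl _).
have dirN e : e \in D -> d != dir e.
  move=> eD; apply/eqP => de; have := rs (dir e).2 (map_f _ eD).
  by rewrite -de /= ltxx => /(_ r0).
pose z := 2^-1 *: d; have z1 := norm_half d1; have z0 := half_neq0 d1.
have zray t : 0 <= t -> t *: z = (t / 2) *: d by rewrite /z scalerA.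
have inD e v t : e \in D -> w \in e.1 -> seg 0 (dir e) v -> 0 <= t -> v = t *: d -> v = 0.
  move=> eD we /segP[t' /andP[t'0 _] vt'] t0 vt; have [e1 _ _] := Dw e eD we.
  have [tE|de] := ray_inj t0 t'0 d1 e1 (etrans (esym vt) vt').
    by rewrite vt tE scale0r.
  by move: (dirN e eD); rewrite de eqxx.
have [|Q [Qz Q1 Qd Qds]] := @bypass d [seq dir e | e <- D & w \in e.1] d1.
  by move=> _ /mapP[e + ->]; rewrite mem_filter => /andP[we eD]; have [] := Dw e eD we.
have zD e : e \in D -> ~ e.2 z.
  move=> eD ez; have [we|nwe] := boolP (w \in e.1).
    have [_ es _] := Dw e eD we; apply: z0; apply: (inD e z 2^-1) => //.
    by apply: es => //; rewrite z1; lra.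
  by have := D1 e eD nwe z ez; rewrite z1; lra.
have [gS cS] : good (put p u z) ([set u; w]%SET, seg 0 z) /\
    forall e, e \in D -> compat (put p u z) ([set u; w]%SET, seg 0 z) e.
  apply: (drawn_inner sD) => //.
  - by apply/arc_sym/arc_seg => /esym.
  - move=> v /segP[t /andP[t0 t1] ->]; rewrite normrZ z1 ger0_norm //; lra.
  - move=> v e /segP[t /andP[t0 t1] vt] eD we se; apply: (inD e v (t / 2)) => //.
      by lra.
    by rewrite vt zray.
have [gQ cQ] : good (put p u z) ([set u; w]%SET, Q) /\
    forall e, e \in D -> compat (put p u z) ([set u; w]%SET, Q) e.
  apply: (drawn_inner sD) => // v e Qv eD we; apply: Qds Qv _ _.
    by apply: map_f; rewrite mem_filter we.
  by rewrite eq_sym dirN.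
exists (put p u z), (([set u; w]%SET, seg 0 z) :: ([set u; w]%SET, Q) :: D).
split => //.
  apply: put_inj => // x _ px; have [xw|/p1] := eqVneq x w.
    by apply: z0; rewrite -/z -px xw.
  by rewrite px z1; lra.
apply/drawn_cons; split => //.
  move=> e; rewrite in_cons => /orP[/eqP ->|]; last exact: cS.
  move=> v /= sv Qv; have [|->|->] := Qd v Qv.
  - case/segP: sv => t /andP[t0 t1] vt; apply/segP; exists (t / 2); first by lra.
    by rewrite vt zray.
  - by exists w; rewrite put_neq 1?eq_sym.
  - by exists u; rewrite put_eq.
apply/drawn_cons; split => //; exact: drawn_put.
Qed.

Lemma plan_pendant u w M : isolated M u -> u != w -> plan M -> plan ([set u; w]%SET :: M).
Proof. by move=> uM uw /(plan_double_pendant uM uw) /plan_behead. Qed.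

(** The arc from [x] is cut at the midpoint of its radius at [w], where [u] is placed; the arc of
    [bypass] doubles the inner half of the radius. *)
Lemma plan_subdivide_double x w u M : isolated M u -> u != x -> u != w ->
  plan ([set x; w]%SET :: M) ->
  plan ([set x; u]%SET :: [set u; w]%SET :: [set u; w]%SET :: M).
Proof.
move=> uM ux uw [p0 [D0 [pi0 DM0 dD0]]].
have [p [D [dir [pi DD dD sD]]]] := drawn_star w pi0 dD0.
move: DD dD sD; rewrite {}DM0 {p0 D0 pi0 dD0}.
case: D => [//|[s A] D] [-> DM] dD [pw p1 D1 Dw].
rewrite -{}DM in uM *; have uD := drawn_iso uM.
have /drawn_cons[/goodP[Axw AV] cA dD'] := dD.
have xw : x != w by apply/eqP => e; move/arc_neq: Axw; rewrite e.
have [|d1 Ad dA] := Dw _ (mem_head _ _); first by rewrite !inE eqxx orbT.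
set d := dir _ in d1 Ad dA.
pose z := 2^-1 *: d; have z1 := norm_half d1; have z0 := half_neq0 d1.
have Az : A z by apply: dA; apply/segP; exists 2^-1 => //; lra.
have [| |B [C [AE mi dBC]]] := drawn_subdivide pi dD uM ux uw Az.
- by move=> zx; have := p1 x xw; rewrite -zx z1; lra.
- by rewrite pw.
have sD : star p w dir D.
  split => // e eD; [apply: D1|apply: Dw]; by rewrite in_cons eD orbT.
(* Edges with the same direction would share the point [d], which has norm one and so is no
   vertex. *)
have dirN e : e \in D -> w \in e.1 -> dir e != d.
  move=> eD we; apply/eqP => de; have [_ _ _ /(_ e eD we)[_ _ es]] := sD.
  have s1 : seg 0 d d by apply/segP; exists 1; rewrite ?ler01 ?lexx ?scale1r.
  have [|t dt] := cA e eD d (dA d s1); first by apply: es; rewrite de.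
  have [tw|/p1] := eqVneq t w; last by rewrite -dt d1 ltxx.
  by move: d1; rewrite dt tw pw normr0 => /eqP; rewrite eq_sym oner_eq0.
have [|Q [Qz Q1 Qd Qds]] := @bypass d [seq dir e | e <- D & w \in e.1] d1.
  move=> _ /mapP[e + ->]; rewrite mem_filter => /andP[we eD].
  by have [_ _ _ /(_ e eD we)[]] := sD.
have [gQ cQ] : good (put p u z) ([set u; w]%SET, Q) /\
    forall e, e \in D -> compat (put p u z) ([set u; w]%SET, Q) e.
  apply: (drawn_inner sD) => // v e Qv eD we; apply: Qds Qv _ _.
    by apply: map_f; rewrite mem_filter we.
  exact: dirN.
have QA v : Q v -> A v -> exists t, v = put p u z t.
  move=> Qv Av; have [|->|->] := Qd v Qv.
  - by apply: Ad => //; apply/ltW/Q1.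
  - by exists w; rewrite put_neq 1?eq_sym.
  - by exists u; rewrite put_eq.
apply: (@plan_perm ([set u; w] :: [set x; u] :: [set u; w] :: map fst D)%SET).
  by apply/seq.permP => P /=; lia.
exists (put p u z), (([set u; w]%SET, Q) :: ([set x; u]%SET, B) :: ([set u; w]%SET, C) :: D).
split => //; apply/drawn_cons; split => // e.
rewrite !in_cons => /or3P[/eqP ->|/eqP ->|]; last exact: cQ.
- by move=> v /= Qv Bv; apply: QA => //; rewrite AE; left.
- by move=> v /= Qv Cv; apply: QA => //; rewrite AE; right.
Qed.

Lemma drawn_compat p D e f : drawn p D -> e \in D -> f \in D -> e != f ->
  compat p e f.
Proof.
elim: D => // g D IH /drawn_cons[_ gc /IH{}IH].
rewrite !in_cons => /orP[/eqP ->|eD] /orP[/eqP ->|fD] ef; first by rewrite eqxx in ef.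
- exact: gc.
- by apply/compat_sym/gc.
- exact: IH.
Qed.

(** The bridge between parametrized drawings of graphs and drawings by point sets; backwards, a
    parametrization is chosen for each edge. *)
Lemma planarP (E : {set {set T}}) : planar R E <-> plan (enum E).
Proof.
split.
  case=> p [g [pi ge gV gC]].
  exists p, [seq (e, g e @` `[0, 1]) | e : {set T} <- enum E].
  have gE (e : {set T}) t : e \in E -> t \in `[0, 1] ->
      (t \in `]0, 1[) \/ (exists x, x \in e /\ g e t = p x).
    move=> eE; rewrite !in_itv /= => /andP[t0 t1].
    have [_ _ [x [y [exy g0 g1]]]] := ge e eE.
    have [tE|tn0] := eqVneq t 0; first by right; exists x; rewrite tE g0 {1}exy set21.
    have [tE|tn1] := eqVneq t 1; first by right; exists y; rewrite tE g1 {1}exy set22.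
    by left; rewrite !lt_neqAle eq_sym tn0 tn1 t0 t1.
  split => //; first by rewrite -map_comp map_id.
  split.
    move=> _ /mapP[e + ->]; rewrite mem_enum => eE; split => /=.
      have [gc gi [x [y [exy g0 g1]]]] := ge e eE.
      by exists x, y; split => //; rewrite -g0 -g1; exact: within_arc.
    move=> x [t t01 gt]; have [to|[y [ye gy]]] := gE e t eE t01.
      by case: (gV e x t eE to).
    by rewrite (_ : x = y) //; apply: pi; rewrite -gt.
  rewrite pairwise_map.
  apply: (@sub_in_pairwise _ (mem E) [rel e f : {set T} | e != f]).
  - move=> e f eE fE /= ef; apply/asboolP => z [s s01 <-] [t t01 gst].
    have [so|[x [_ ->]]] := gE e s eE s01; last by exists x.
    have [to|[x [_ gx]]] := gE f t fE t01; last by exists x; rewrite -gst.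
    by case: (gC e f s t eE fE ef so to).
  - by apply/allP => e; rewrite mem_enum.
  - by rewrite -uniq_pairwise enum_uniq.
case=> p [D [pi DE dD]]; have [gD _] := dD.
pose Q (e : {set T}) (g : R -> R * R) := e \in E ->
  [/\ continuous g, {in `[0, 1] &, injective g}, (e, g @` `[0, 1]) \in D
    & exists x y, [/\ e = [set x; y]%SET, g 0 = p x & g 1 = p y]].
have [|g gP] := @choice _ _ Q.
  move=> e; have [eE|neE] := boolP (e \in E); last by exists (fun=> 0); rewrite /Q (negbTE neE).
  have : e \in map fst D by rewrite DE mem_enum.
  case/mapP => -[e' A] eD /= ee'; have := gD _ eD; rewrite -{}ee' in eD *.
  case=> -[x [y /= [exy [g [gc gi g0 g1 gA]]]]] _.
  by exists g; split; rewrite -?gA //; exists x, y.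
have gV (e : {set T}) x t : e \in E -> t \in `]0, 1[ -> g e t <> p x.
  move=> eE t01; have [gc gi geD [y [y' [eyy g0 g1]]]] := gP e eE.
  have t01' : t \in `[0, 1] by move: t01; rewrite !in_itv /= => /andP[/ltW -> /ltW ->].
  have inj s : s \in `[0, 1] -> g e t = g e s -> t = s by move=> ?; exact: gi.
  move=> gt; have xe : x \in e by have [_ /= gV] := gD _ geD; apply: gV; exists t.
  move: xe t01; rewrite {1}eyy in_set2 in_itv /= => /orP[] /eqP xE.
    by rewrite (inj 0) ?ltxx // ?in_itv /= ?lexx ?ler01 // gt g0 xE.
  by rewrite (inj 1) ?ltxx ?andbF // ?in_itv /= ?lexx ?ler01 // gt g1 xE.
exists p, g; split => // [e eE|e f s t eE fE ef s01 t01 gst].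
  have [gc gi _ gxy] := gP e eE.
  by split => //; exact: continuous_subspaceT.
have [_ _ eD _] := gP e eE; have [_ _ fD _] := gP f fE.
have io (v : R) : v \in `]0, 1[ -> (`[0, 1]%classic : set R) v.
  by rewrite /= !in_itv /= => /andP[/ltW -> /ltW ->].
have [|||x gx] := drawn_compat dD eD fD _ (z := g e s).
- by apply: contra ef => /eqP[->].
- by exists s => //; exact: io.
- by exists t; [exact: io|rewrite gst].
- exact: (gV e x s).
Qed.

End Drawings.

(** * Labelling the vertices *)

Section Labelling.
Variables (R : realType) (T : finType).
Implicit Types (M N : seq {set T}) (W : {set T}) (u w x y : T).
Local Notation plan := (@plan R T).
Local Open Scope nat_scope.

Definition degree M u := count (fun s : {set T} => u \in s) M.

Lemma degree_perm M N u : perm_eq M N -> degree M u = degree N u.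
Proof. by move=> MN; exact: (seq.permP MN). Qed.

Lemma degree0 M u : degree M u = 0 -> isolated M u.
Proof.
move=> d0 s sM; apply/negP => us; suff : 0 < degree M u by rewrite d0.
by rewrite -has_count; apply/hasP; exists s.
Qed.

Lemma degree_gt0 M u : plan M -> 0 < degree M u ->
  exists p N, p != u /\ perm_eq M ([set u; p]%SET :: N).
Proof.
move=> pM; rewrite -has_count => /hasP[s sM us].
have /eqP/cards2P[x [y [xy sE]]] := plan_card2 pM sM.
move: us sM; rewrite sE !inE => /orP[] /eqP -> sM.
  exists y, (rem [set x; y]%SET M); rewrite eq_sym xy; split => //.
  exact: perm_to_rem.
exists x, (rem [set x; y]%SET M); rewrite xy finset.setUC; split => //.
exact: perm_to_rem.
Qed.

Lemma plan_perm_cons s M N : perm_eq M N -> plan (s :: N) -> plan (s :: M).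
Proof. by move=> MN; apply: plan_perm; rewrite perm_cons perm_sym. Qed.

(* [t] counts the tree components, whose vertices all get the label [0]. *)
Definition labelling W M (phi : T -> nat) t l :=
  [/\ t <= #|[set x in W | phi x == 0]%SET|,
    forall x, x \in W -> phi x <= l,
    l + 5 * #|W| <= 5 * (size M + t)
    & forall x y, x \in W -> y \in W -> x != y -> phi x = phi y ->
      plan ([set x; y]%SET :: M)].

Definition relabel (phi : T -> nat) u k x := if x == u then k else phi x.

Lemma relabel_class W (phi : T -> nat) u k : u \in W ->
  #|[set x in W | relabel phi u k x == 0]%SET| =
  (k == 0) + #|[set x in W :\ u | phi x == 0]%SET|.
Proof.
move=> uW; rewrite (cardsD1 u) !inE uW /relabel eqxx /=; congr (_ + _).
by apply: eq_card => x; rewrite !inE; case: (x == u).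
Qed.

(** One peeling step: [N] is the multigraph after [u] has been peeled off, and [u] gets the label
    [k]. If [k > l], this label is new and the last premise is vacuous. *)
Lemma labelling_extend W M N phi u k t t' l l' : u \in W ->
  labelling (W :\ u) N phi t l ->
  t' <= t + (k == 0) -> k <= l' -> l <= l' ->
  l' + 5 * #|W| <= 5 * (size M + t') ->
  (forall x y, x != u -> y != u -> x != y -> plan ([set x; y]%SET :: N) ->
    plan ([set x; y]%SET :: M)) ->
  (forall y, y \in W -> y != u -> phi y = k -> plan ([set u; y]%SET :: M)) ->
  labelling W M (relabel phi u k) t' l'.
Proof.
move=> uW [tW lW _ NW] tt kl ll sl NM uM; split => //.
- by rewrite relabel_class //; lia.
- move=> x xW; rewrite /relabel; case: eqVneq => // xu.
  by apply: leq_trans ll; apply: lW; rewrite !inE xu.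
- move=> x y xW yW xy; rewrite /relabel.
  case: eqVneq => [xu|xu]; case: eqVneq => [yu|yu].
  + by rewrite xu yu eqxx in xy.
  + by move=> /esym ky; rewrite xu; exact: uM.
  + by move=> kx; rewrite yu finset.setUC; exact: uM.
  + by move=> e; apply: NM => //; apply: NW; rewrite ?inE ?xu ?yu.
Qed.

Lemma sub_rem W M N u : isolated N u -> (forall s, s \in M -> s \subset W) ->
  {subset N <= M} -> forall s, s \in N -> s \subset W :\ u.
Proof. by move=> uN MW NM s sN; rewrite subsetD1 uN // MW // NM. Qed.

(** Induction on the number of vertices. The invariant says that [l] is at most 5 times
    [size M - #|W| + t]. An isolated vertex changes [#|W|] and [t] by one each; a leaf or a
    suppressed vertex changes [size M] and [#|W|] by one each. *)
Lemma labellingP W M : plan M -> (forall s, s \in M -> s \subset W) ->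
  exists phi t l, labelling W M phi t l.
Proof.
have [n] := ubnP #|W|; elim: n W M => // n IH W M; rewrite ltnS => Wn pM MW.
have cW u : u \in W -> #|W| = #|W :\ u|.+1 by move=> uW; rewrite (cardsD1 u W) uW.
have IH' u N : u \in W -> plan N -> isolated N u -> {subset N <= M} ->
    exists phi t l, labelling (W :\ u) N phi t l.
  move=> uW pN uN NM; apply: IH => //; first by rewrite -(cW u uW).
  exact: sub_rem uN MW NM.
(* An isolated vertex can be joined to any other, so it takes the label [0] and raises [t]. *)
have [/exists_inP[u uW /eqP du]|/exists_inPn nd0] :=
  boolP [exists u in W, degree M u == 0].
  have uM := degree0 du.
  have [phi [t [l L]]] := IH' u M uW pM uM (fun s h => h).
  have [tW lW sW NW] := L.
  exists (relabel phi u 0), t.+1, l; apply: (labelling_extend uW L) => //=.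
  - by rewrite addn1.
  - by rewrite (cW u uW); move: sW; clear; lia.
  - by move=> y yW yu _; apply: plan_pendant => //; rewrite eq_sym.
(* A leaf [u] takes the label of its neighbour [p]: if [u] subdivides a new edge from [p] to [y],
   the result is the old edge at [u] and a new one from [u] to [y]. For [y = p] the pendant edge is
   doubled. *)
have [/exists_inP[u uW /eqP du]|/exists_inPn nd1] :=
  boolP [exists u in W, degree M u == 1].
  have [|p [N [pu MN]]] := @degree_gt0 M u pM; first by rewrite du.
  have uN : isolated N u.
    by apply: degree0; move: du; rewrite (degree_perm u MN) /degree /= !inE eqxx; rewrite /degree; clear; lia.
  have pN := plan_behead (plan_perm MN pM).
  have NM : {subset N <= M} by move=> s sN; rewrite (perm_mem MN) in_cons sN orbT.
  have [phi [t [l L]]] := IH' u N uW pN uN NM; have [tW lW sW NW] := L.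
  have pW : p \in W.
    have /MW/fintype.subsetP : [set u; p]%SET \in M by rewrite (perm_mem MN) mem_head.
    by apply; rewrite set22.
  have pWu : p \in W :\ u by rewrite !inE pu.
  have sM : size M = (size N).+1 by rewrite (perm_size MN).
  exists (relabel phi u (phi p)), t, l; apply: (labelling_extend uW L) => //.
  - by rewrite leq_addr.
  - exact: lW.
  - by rewrite (cW u uW) sM; move: sW; clear; lia.
  - move=> x y xu yu xy pxy; apply: (plan_perm_cons MN).
    apply: (@plan_perm _ _ ([set u; p] :: [set x; y] :: N)%SET).
      by apply/seq.permP => P /=; clear; lia.
    apply: plan_pendant => //; last by rewrite eq_sym.
    move=> s; rewrite in_cons => /orP[/eqP ->|]; last exact: uN.
    by rewrite !inE negb_or eq_sym xu eq_sym yu.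
  - move=> y yW yu ey; apply: (plan_perm_cons MN).
    have [->|yp] := eqVneq y p; first by apply: plan_double_pendant; rewrite // eq_sym.
    apply: (@plan_perm _ _ ([set p; u] :: [set u; y] :: N)%SET).
      by rewrite (finset.setUC [set p]%SET); apply/seq.permP => P /=; clear; lia.
    apply: plan_subdivide; rewrite // 1?eq_sym //.
    by apply: NW; rewrite ?ey // ?inE ?yu // eq_sym.
have [/hasP[s sM /forall_inP s2]|/hasPn nd2] :=
  boolP (has (fun s : {set T} => [forall u in s, degree M u == 2]) M).
  have /eqP/cards2P[u [p [up sE]]] := plan_card2 pM sM.
  have du : degree M u = 2 by apply/eqP/s2; rewrite sE set21.
  have dp : degree M p = 2 by apply/eqP/s2; rewrite sE set22.
  have uW : u \in W by apply: (fintype.subsetP (MW s sM)); rewrite sE set21.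
  have pW : p \in W by apply: (fintype.subsetP (MW s sM)); rewrite sE set22.
  have MN0 := perm_to_rem sM; rewrite sE in MN0; set N0 := rem _ M in MN0.
  have pN0 := plan_behead (plan_perm MN0 pM).
  have [|q [N [qu N0N]]] := @degree_gt0 N0 u pN0.
    by move: du; rewrite (degree_perm u MN0) /degree /= !inE eqxx; rewrite /degree; clear; lia.
  have MN : perm_eq M ([set u; p] :: [set u; q] :: N)%SET.
    by rewrite (perm_trans MN0) // perm_cons.
  have uN : isolated N u.
    apply: degree0; move: du; rewrite (degree_perm u MN) /degree /= !inE eqxx.
    by rewrite /degree; clear; lia.
  have pM' := plan_perm MN pM; have pN := plan_behead (plan_behead pM').
  have NM : {subset N <= M}.
    by move=> r rN; rewrite (perm_mem MN) !in_cons rN !orbT.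
  have size_M : size M = (size N).+2 by rewrite (perm_size MN).
  (* If [q = p], then [u] and [p] form a component with two parallel edges. Two edges vanish with
     one vertex, which leaves room for a fresh label. *)
  have [qp|qp] := eqVneq q p.
    rewrite {}qp in MN.
    have [phi [t [l L]]] := IH' u N uW pN uN NM; have [tW lW sW NW] := L.
    exists (relabel phi u l.+1), t, l.+1; apply: (labelling_extend uW L) => //.
    - by rewrite leq_addr.
    - by rewrite (cW u uW) size_M; move: sW; clear; lia.
    - move=> x y xu yu xy pxy; apply: (plan_perm_cons MN).
      apply: (@plan_perm _ _ ([set u; p] :: [set u; p] :: [set x; y] :: N)%SET).
        by apply/seq.permP => P /=; clear; lia.
      apply: plan_double_pendant => // r; rewrite in_cons => /orP[/eqP ->|]; last exact: uN.
      by rewrite !inE negb_or eq_sym xu eq_sym yu.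
    - move=> y yW yu yl; have := lW y; rewrite !inE yu yW yl => /(_ isT).
      by rewrite ltnn.
  (* Suppressing [u] merges its two edges; [u] inherits the label of [p]. *)
  have pNq : plan ([set p; q]%SET :: N).
    apply: (@plan_suppress _ _ _ _ u) => //; first by rewrite eq_sym.
    by rewrite (finset.setUC [set p]%SET).
  have [phi [t [l L]]] : exists phi t l, labelling (W :\ u) ([set p; q]%SET :: N) phi t l.
    apply: IH => //; first by rewrite -(cW u uW).
    move=> r; rewrite in_cons => /orP[/eqP ->|]; last exact: (sub_rem uN MW NM).
    rewrite finset.subUset !finset.sub1set !inE pW (eq_sym p) up qu.
    have /MW/fintype.subsetP : [set u; q]%SET \in M.
      by rewrite (perm_mem MN) !in_cons eqxx orbT.
    by apply; rewrite set22.
  have [tW lW sW NW] := L.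
  have [|p0 [K [p0p NK]]] := @degree_gt0 N p pN.
    move: dp; rewrite (degree_perm p MN) /degree /= !inE eqxx orbT (eq_sym p).
    by rewrite (negbTE up) eq_sym (negbTE qp); rewrite /degree; clear; lia.
  have pK : isolated K p.
    apply: degree0; move: dp; rewrite (degree_perm p MN) /degree /= !inE eqxx orbT (eq_sym p).
    rewrite (negbTE up) eq_sym (negbTE qp) /= -/(degree N p) (degree_perm p NK).
    by rewrite /degree /= !inE eqxx; rewrite /degree; clear; lia.
  have uK : isolated K u by move=> r rK; apply: uN; rewrite (perm_mem NK) in_cons rK orbT.
  have p0u : p0 != u.
    apply/eqP => e; have := uN [set p; p0]%SET.
    by rewrite (perm_mem NK) mem_head e set22 => /(_ isT).
  have MK : perm_eq M ([set u; p] :: [set u; q] :: [set p; p0] :: K)%SET.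
    by rewrite (perm_trans MN) // !perm_cons.
  (* [p] has degree two, so [p] and [u] may be exchanged. *)
  have swap L0 : isolated L0 p -> isolated L0 u ->
      [seq (tperm p u @: r)%SET | r : {set T} <- L0] = L0.
    move=> pL uL; rewrite -[RHS]map_id; apply/eq_in_map => r rL /=.
    rewrite -[RHS]imset_id; apply: eq_in_imset => v vr.
    by rewrite tpermD //; apply/eqP => ev; [have := pL _ rL|have := uL _ rL]; rewrite ev vr.
  have tE x y : (tperm p u @: [set x; y] = [set tperm p u x; tperm p u y])%SET.
    by rewrite imsetU1 imset_set1.
  have pu' : p != u by rewrite eq_sym.
  have tD x : x != p -> x != u -> tperm p u x = x by move=> *; rewrite tpermD // eq_sym.
  exists (relabel phi u (phi p)), t, l; apply: (labelling_extend uW L) => //.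
  - by rewrite leq_addr.
  - by apply: lW; rewrite !inE pu'.
  - by rewrite (cW u uW) size_M; move: sW => /=; clear; lia.
  - move=> x y xu yu xy pxy; apply: (plan_perm_cons MN).
    apply: (@plan_perm _ _ ([set p; u] :: [set u; q] :: [set x; y] :: N)%SET).
      by rewrite (finset.setUC [set p]%SET); apply/seq.permP => P /=; clear; lia.
    apply: plan_subdivide => //.
    - move=> r; rewrite in_cons => /orP[/eqP ->|]; last exact: uN.
      by rewrite !inE negb_or eq_sym xu eq_sym yu.
    - by rewrite eq_sym.
    - by apply: plan_perm pxy; apply/seq.permP => P /=; clear; lia.
  (* After the exchange of names, [p] returns by subdividing the edge from [p0] to [u]. If [y = p],
     the new half between [p] and [u] is doubled; otherwise the new edge from [p] to [y] has become
     one from [u] to [y]. *)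
  - move=> y yW yu ey; apply: (plan_perm_cons MK).
    have [->|yp] := eqVneq y p.
      have : plan ([set p0; u] :: [set u; q] :: K)%SET.
        have /(plan_rename (tperm p u)) : plan ([set p; q] :: [set p; p0] :: K)%SET.
          by apply: plan_perm pNq; rewrite perm_cons.
        rewrite /= swap // !tE tpermL !tD //.
        by apply: plan_perm; rewrite (finset.setUC [set p0]%SET); apply/seq.permP => P /=; clear; lia.
      move=> /(@plan_subdivide_double _ _ p0 u p).
      rewrite (finset.setUC [set p0]%SET) (finset.setUC [set p]%SET [set u]%SET) => H.
      apply: (@plan_perm _ _ ([set p; p0] :: [set u; p] :: [set u; p] :: [set u; q] :: K)%SET).
        by apply/seq.permP => P /=; clear; lia.
      apply: H => //; last by rewrite eq_sym.
      move=> r; rewrite in_cons => /orP[/eqP ->|]; last exact: pK.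
      by rewrite !inE negb_or pu' eq_sym.
    have : plan ([set p0; u] :: [set u; y] :: [set u; q] :: K)%SET.
      have /(plan_rename (tperm p u)) : plan ([set p; y] :: [set p; q] :: [set p; p0] :: K)%SET.
        have : plan ([set p; y] :: [set p; q] :: N)%SET.
          by apply: NW; rewrite ?ey // ?inE ?pu' ?yu // eq_sym.
        by apply: plan_perm; rewrite !perm_cons.
      rewrite /= swap // !tE tpermL !tD //.
      by apply: plan_perm; rewrite (finset.setUC [set p0]%SET); apply/seq.permP => P /=; clear; lia.
    move=> /(@plan_subdivide _ _ p0 u p).
    rewrite (finset.setUC [set p0]%SET) (finset.setUC [set p]%SET [set u]%SET) => H.
    apply: (@plan_perm _ _ ([set p; p0] :: [set u; p] :: [set u; y] :: [set u; q] :: K)%SET).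
      by apply/seq.permP => P /=; clear; lia.
    apply: H => //; last by rewrite eq_sym.
    move=> r; rewrite !in_cons => /or3P[/eqP ->|/eqP ->|]; last exact: pK.
      by rewrite !inE negb_or pu' eq_sym.
    by rewrite !inE negb_or pu' eq_sym.
(* Discharging: with weight 3 at degree two and 2 at larger degree, degree times weight is at least
   6 at every vertex, while an edge collects at most 5, as its ends do not both have degree two. *)
have big : 6 * #|W| <= 5 * size M.
  pose wt x := if degree M x == 2 then 3 else 2.
  have dsum x : degree M x = \sum_(s <- M) (x \in s).
    by rewrite /degree -sum1_count big_mkcond; apply: eq_bigr => s _; case: ifP.
  apply: (@leq_trans (\sum_(x in W) degree M x * wt x)).
    rewrite mulnC -sum_nat_const; apply: leq_sum => x xW.
    have := nd0 x xW; have := nd1 x xW; rewrite /wt.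
    by case: (degree M x) => [//|[//|[//|d]]] _ _ /=; clear; lia.
  rewrite (eq_bigr (fun x => \sum_(s <- M) (x \in s) * wt x)); last first.
    by move=> x _; rewrite dsum big_distrl.
  rewrite exchange_big /= -sum1_size big_distrr /=.
  rewrite big_seq_cond [X in _ <= X]big_seq_cond; apply: leq_sum => s /andP[sM _].
  rewrite muln1; apply: (@leq_trans (\sum_(x in s) wt x)).
    rewrite [X in _ <= X]big_mkcond /= [X in X <= _]big_mkcond /=.
    by apply: leq_sum => x _; case: (x \in W); case: (x \in s); rewrite ?mul1n.
  have /eqP/cards2P[x [y [xy sE]]] := plan_card2 pM sM.
  have := nd2 s sM; rewrite sE big_setU1 ?inE // big_set1 /wt.
  case: eqVneq => // dx; case: eqVneq => // dy /negP[].
  by apply/forall_inP => z; rewrite !inE => /orP[] /eqP ->; apply/eqP.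
(* All labels are distinct, and [big] is the bound on [l] for [t = 0]. *)
exists (fun x => (index x (enum W)).+1), 0, #|W|; split => //.
- by move=> x xW; rewrite cardE index_mem mem_enum.
- by rewrite -mulSn addn0.
- move=> x y xW yW xy [exy]; case/eqP: xy.
  by rewrite -(nth_index x (s := enum W) (x := x)) ?mem_enum // exy nth_index ?mem_enum.
Qed.

End Labelling.

(** * Counting planar graphs *)

Section Counting.
Variable R : realType.
Local Open Scope nat_scope.

Definition addable (T : finType) (E : {set {set T}}) : {set {set T}} :=
  [set e : {set T} | [&& #|e| == 2, e \notin E & `[< planar R (e |: E) >]]]%SET.

(** With few classes this forces many pairs within classes; it sums the inequality between
    [2 * a * c i] and [c i ^ 2 + a ^ 2]. *)
Lemma sum_sqr_ge (I : finType) (c : I -> nat) a :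
  2 * a * \sum_i c i <= \sum_i c i ^ 2 + a ^ 2 * #|I|.
Proof.
rewrite [a ^ 2 * _]mulnC -[_ * a ^ 2]sum_nat_const big_distrr -big_split /=.
by apply: leq_sum => i _; rewrite -mulnA addnC; exact: nat_Cauchy.
Qed.

Lemma card_classes (T I : finType) (f : T -> I) :
  #|T| = \sum_i #|[set x | f x == i]%SET|.
Proof.
rewrite -sum1_card (partition_big f xpredT) //=; apply: eq_bigr => i _.
by rewrite -sum1_card; apply: eq_bigl => x; rewrite inE.
Qed.

Lemma card_same_class (T I : finType) (f : T -> I) :
  #|[set z : T * T | f z.1 == f z.2]%SET| = \sum_i #|[set x | f x == i]%SET| ^ 2.
Proof.
rewrite -sum1_card (partition_big (fun z : T * T => f z.1) xpredT) //=.
apply: eq_bigr => i _; rewrite -mulnn -cardsX -sum1_card; apply: eq_bigl => -[x y].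
rewrite !inE /= andbC; case: (eqVneq (f x) i) => [->|//].
by rewrite eq_sym.
Qed.

Lemma card_pairs_le (T : finType) (B : {set T * T}) (F : {set {set T}}) :
  (forall z, z \in B -> [set z.1; z.2]%SET \in F) ->
  (forall z, z \in B -> z.1 != z.2) -> #|B| <= 2 * #|F|.
Proof.
move=> BF Bn; rewrite -sum1_card.
rewrite (partition_big (fun z : T * T => [set z.1; z.2]%SET) (mem F)) //=.
rewrite mulnC -sum_nat_const; apply: leq_sum => e _.
have [[z zB ze]|no] := pselect (exists2 z, z \in B & [set z.1; z.2]%SET = e).
  rewrite sum1_card -(_ : #|[set (z.1, z.2); (z.2, z.1)]%SET| = 2); last first.
    by rewrite cards2 xpair_eqE (negbTE (Bn z zB)).
  apply/subset_leq_card/fintype.subsetP => -[x y]; rewrite -ze unfold_in /= => /andP[_ /eqP].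
  by rewrite !inE => /set2_inj[] [-> ->]; rewrite eqxx ?orbT.
rewrite big1 // => z /andP[zB /eqP ze]; case: no; by exists z.
Qed.

(** [S] counts ordered pairs with equal labels: either the class of [0] is large or there are few
    labels. The diagonal costs [#|T|], hence [K.+1]; pairs already joined account for the summand
    [#|E|]. *)
Lemma addable_many (T : finType) (E : {set {set T}}) K q :
  planar R E -> q = 20 * K.+1 -> q * #|E| <= q.+1 * #|T| ->
  K.+1 * q ^ 2 <= #|T| -> K * #|T| <= 2 * (#|addable E| + #|E|).
Proof.
move=> /planarP pE qE qm nK.
have [phi [t [l [tW lW sW pW]]]] : exists phi t l, labelling R [set: T]%SET (enum E) phi t l.
  by apply: labellingP => // s _; exact: finset.subsetT.
rewrite finset.cardsT -cardE in sW.
pose f x : 'I_l.+1 := inord (phi x).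
have fE x y : (f x == f y) = (phi x == phi y).
  rewrite -val_eqE /= !inordK // ltnS; exact: lW.
pose S := \sum_i #|[set x | f x == i]%SET| ^ 2.
have Sge : K.+1 * #|T| <= S.
  (* With [n = #|T|], a class of size at least [n / q] gives [S] at least [(n / q) ^ 2], which [nK]
     makes large enough. *)
  have [tq|tq] := leqP #|T| (q * t).
    have : t ^ 2 <= S.
      rewrite /S (bigD1 (inord 0)) //= (leq_trans _ (leq_addr _ _)) // leq_exp2r //.
      apply: leq_trans tW _; apply/subset_leq_card/fintype.subsetP => x.
      rewrite !inE => /eqP px; rewrite -val_eqE /= /f px; exact: eqxx.
    have : #|T| ^ 2 <= (q * t) ^ 2 by rewrite leq_exp2r.
    have q0 : 0 < q by rewrite qE.
    move: nK q0; clear; move: #|T| => n; rewrite -!mulnn => *; nia.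
  have := sum_sqr_ge (fun i => #|[set x | f x == i]%SET|) K.+1.
  rewrite -card_classes card_ord -/S.
  (* Both [#|E| - n] and [t] are at most [n / q], so [l] is at most [10 n / q], which is
     [n / (2 (K + 1))]; hence the factor 20 in [q]. *)
  have : K.+1 * l.+1 <= #|T|.
    have : q * (l + 5 * #|T|) <= q * (5 * (#|E| + t)) by rewrite leq_mul2l sW orbT.
    move: qm tq nK; rewrite qE -mulnn; clear; move: #|T| #|E| => n m.
    rewrite (_ : 20 * K.+1 * (l + 5 * n) = 20 * (K.+1 * l) + 100 * (K.+1 * n)); last by lia.
    move=> h1 h2 h3 h4; nia.
  by rewrite -!mulnn; clear; move: #|T| S => n s; nia.
pose B := [set z : T * T | (z.1 != z.2) && (f z.1 == f z.2)]%SET.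
have BE : K * #|T| <= #|B|.
  rewrite -(leq_add2r #|T|) -mulSnr; apply: leq_trans Sge _.
  rewrite /S -card_same_class.
  apply: (@leq_trans (#|B :|: [set (x, x) | x : T]|)%SET).
    apply/subset_leq_card/fintype.subsetP => -[x y]; rewrite !inE /= => ->.
    rewrite andbT; case: eqVneq => //= ->; apply/imsetP; by exists y.
  rewrite cardsU; apply: leq_trans (leq_subr _ _) _.
  by rewrite leq_add2l; exact: leq_imset_card.
apply: leq_trans BE _; apply: (@leq_trans (2 * #|addable E :|: E|)%SET).
  apply: card_pairs_le => z; rewrite inE => /andP[zn] //; rewrite fE => /eqP fz.
  rewrite !inE; have [zE|zE] := boolP (_ \in E); rewrite ?orbT // orbF cards2 zn /=.
  apply/asboolP/planarP; apply: plan_perm (pW z.1 z.2 _ _ zn fz); rewrite ?inE //.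
  rewrite perm_sym; apply: uniq_perm => [||s]; rewrite ?enum_uniq //=.
    by rewrite mem_enum zE enum_uniq.
  by rewrite !(inE, mem_enum).
by rewrite leq_mul2l /= cardsU leq_subr.
Qed.

Lemma planar_graphsP n m (E : {set {set 'I_n}}) : reflect
  [/\ is_graph E, #|E| = m & planar R E] (E \in planar_graphs R n m).
Proof.
rewrite inE; apply: (iffP and3P) => -[gE /eqP mE pE]; split => //; exact/asboolP.
Qed.

Lemma addable_graph n m (E : {set {set 'I_n}}) e : E \in planar_graphs R n m ->
  e \in addable E -> (e |: E)%SET \in planar_graphs R n m.+1.
Proof.
move=> /planar_graphsP[gE mE pE]; rewrite inE => /and3P[e2 eE /asboolP pe].
apply/planar_graphsP; split => //; last by rewrite cardsU1 eE mE.
by apply/forall_inP => s; rewrite !inE => /orP[/eqP -> //|]; move/forall_inP: gE; exact.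
Qed.

Lemma card_dep_pairs (S T : finType) (P : {set S}) (Q : S -> {set T}) :
  #|[set z : S * T | (z.1 \in P) && (z.2 \in Q z.1)]%SET| = \sum_(x in P) #|Q x|.
Proof.
under eq_bigr do rewrite -sum1_card.
rewrite pair_big_dep -sum1_card; apply: eq_bigl => z; by rewrite inE.
Qed.

(** Double counting: adding the pair and marking it is injective, since deleting the marked edge
    restores the graph. *)
Lemma sum_addable n m : \sum_(E in planar_graphs R n m) #|addable E| <=
  m.+1 * #|planar_graphs R n m.+1|.
Proof.
pose X := [set z : {set {set 'I_n}} * {set 'I_n} |
  (z.1 \in planar_graphs R n m) && (z.2 \in addable z.1)]%SET.
pose Y := [set z : {set {set 'I_n}} * {set 'I_n} |
  (z.1 \in planar_graphs R n m.+1) && (z.2 \in z.1)]%SET.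
have XE : #|X| = \sum_(E in planar_graphs R n m) #|addable E| by rewrite card_dep_pairs.
have YE : #|Y| = m.+1 * #|planar_graphs R n m.+1|.
  rewrite (card_dep_pairs (planar_graphs R n m.+1) (fun E => E)) mulnC -sum_nat_const.
  apply: eq_bigr => E.
  by case/planar_graphsP.
rewrite -XE -YE; pose h (z : {set {set 'I_n}} * {set 'I_n}) := ((z.2 |: z.1)%SET, z.2).
rewrite -(@card_in_imset _ _ h X).
  apply/subset_leq_card/fintype.subsetP => _ /imsetP[[E e] + ->].
  rewrite inE => /andP[/= EP eE]; rewrite inE /= (addable_graph EP eE).
  exact: setU11.
move=> [E e] [E' e']; rewrite inE => /andP[_ /=]; rewrite inE => /and3P[_ eE _].
rewrite inE => /andP[_ /=]; rewrite inE => /and3P[_ eE' _].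
case=> EE ee; subst e'; congr pair.
by rewrite -(setU1K eE) EE setU1K.
Qed.

Lemma graph_count_growth J : exists q n0, 0 < q /\ forall n m, n0 <= n ->
  q * m <= q.+1 * n -> J * #|planar_graphs R n m| <= #|planar_graphs R n m.+1|.
Proof.
(* Since [m] is at most [2 n], the pairs already joined cost at most [4 n] per graph, and
   [2 (m + 1)] is at most [6 n]. *)
pose K := 6 * J + 4; pose q := 20 * K.+1.
exists q, (K.+1 * q ^ 2); split => // n m n0 qm.
have := sum_addable n m; set N := #|planar_graphs R n m|; set N' := #|_| => sN.
have : N * (K * n) <= 2 * (\sum_(E in planar_graphs R n m) #|addable E| + N * m).
  rewrite -!sum_nat_const -big_split big_distrr /=; apply: leq_sum => E.
  case/planar_graphsP => gE mE pE; rewrite -mE -{1}(card_ord n).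
  by apply: (addable_many pE (q := q)); rewrite // card_ord ?mE.
have n1 : 0 < n by apply: leq_trans n0; rewrite muln_gt0 expn_gt0.
have m2 : m <= 2 * n by move: qm n1; rewrite /q; clear; nia.
move: sN n1 m2; rewrite /K; move: (\sum_(_ in _) _) => s; clear.
move: n m s J N N' => n m s J N N' h1 n1 m2 h2.
have h3 : N * n * (6 * J) <= N' * n * 6 by nia.
by rewrite -(@leq_pmul2l (n * 6)) ?muln_gt0 ?n1 //; nia.
Qed.

(** One step supplies the factor [J]; the others do not decrease the count, as [J] is positive. *)
Lemma graph_count_growth_iter J c : 0 < J -> 0 < c ->
  exists q n0, 0 < q /\ forall n m, n0 <= n -> c <= m ->
  q * m <= q.+1 * n -> J * #|planar_graphs R n (m - c)| <= #|planar_graphs R n m|.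
Proof.
move=> J0 c0; have [q [n0 [q0 step]]] := graph_count_growth J.
exists q, n0; split => // n m nn cm qm; elim: c c0 cm => // c IH _ cm.
have {}step k : k < m -> J * #|planar_graphs R n k| <= #|planar_graphs R n k.+1|.
  by move=> km; apply: step => //; apply: leq_trans qm; rewrite leq_mul2l (ltnW km) orbT.
have := step (m - c.+1); rewrite subnSK // leq_subLR => /(_ _).
case: c IH cm => [_ cm|c IH cm]; first by rewrite subn0; apply; rewrite addnC leq_addr.
move=> H; apply: leq_trans (H _) _; first by rewrite addnC leq_addr.
by apply: leq_trans (IH _ _) => //; [exact: leq_pmull|exact: ltnW].
Qed.

(** * Dissolving a component isomorphic to [H] *)

Lemma plan_enumS (T : finType) (E F : {set {set T}}) : E \subset F ->
  plan R (enum F) -> plan R (enum E).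
Proof.
move=> /fintype.subsetP EF pF.
apply: (plan_perm _ (plan_subseq (filter_subseq (fun e => e \in E) (enum F)) pF)).
apply: uniq_perm; [exact: filter_uniq (enum_uniq _)|exact: enum_uniq|move=> e].
rewrite mem_filter !mem_enum; apply/andP/idP => [[]//|eE].
by split => //; exact: EF.
Qed.

Lemma plan_pendants (U : eqType) (T : finType) (f g : U -> T) us M :
  uniq us -> injective f -> (forall u v, g u != f v) ->
  (forall u, isolated M (f u)) -> plan R M ->
  plan R ([seq [set f u; g u]%SET | u <- us] ++ M).
Proof.
move=> us_uniq fi gf fM pM; elim: us us_uniq => //= u us IH /andP[uus /IH{}IH].
apply: plan_pendant => //; last by rewrite eq_sym.
move=> s; rewrite mem_cat => /orP[/mapP[v vus ->]|]; last exact: fM.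
rewrite !inE negb_or (eq_sym (f u) (g v)) gf andbT.
by apply: contra uus => /eqP/fi ->.
Qed.

Definition embeds (U T : finType) (EH : {set {set U}}) (E : {set {set T}})
    (f : {ffun U -> T}) :=
  [/\ injective f, (f @: [set: U])%SET \in components E
    & forall x y, adj EH x y = adj E (f x) (f y)].

Lemma has_component_isoP (U T : finType) (EH : {set {set U}}) (E : {set {set T}}) :
  has_component_iso EH E -> exists f, embeds EH E f.
Proof.
case/exists_inP => C CE /existsP[f /and3P[/injectiveP fi /eqP fC /forallP fE]].
exists f; split => //; first by rewrite fC.
by move=> x y; apply/eqP; exact: (forallP (fE x)).
Qed.

Lemma component_closed (T : finType) (E : {set {set T}}) C e :
  is_graph E -> C \in components E -> e \in E -> ~~ [disjoint e & C] -> e \subset C.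
Proof.
move=> /forall_inP gE /imsetP[x _ ->] eE.
have /cards2P[a [b [_ eab]]] := gE e eE.
have ab : adj E a b by rewrite /adj -eab.
have ba : adj E b a by rewrite /adj finset.setUC -eab.
rewrite -setI_eq0 => /set0Pn[c]; rewrite !inE => /andP[ce xc].
apply/fintype.subsetP => d; rewrite inE; move: ce; rewrite eab !inE.
move=> /orP[] /eqP cE /orP[] /eqP ->; rewrite -?cE //.
  by apply: connect_trans xc _; rewrite cE; exact: connect1.
by apply: connect_trans xc _; rewrite cE; exact: connect1.
Qed.

Definition outside (T : finType) (E : {set {set T}}) (C : {set T}) :=
  [set e in E | [disjoint e & C]]%SET.

Lemma embeds_split (U T : finType) (EH : {set {set U}}) (E : {set {set T}}) f :
  is_graph EH -> is_graph E -> embeds EH E f ->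
  E = (outside E (f @: [set: U]) :|: [set (f @: e)%SET | e : {set U} in EH])%SET.
Proof.
move=> /forall_inP gH gE [fi fC fE]; apply/setP => e; rewrite inE; apply/idP/orP.
  move=> eE; have [de|nde] := boolP [disjoint e & (f @: [set: U])%SET].
    by left; rewrite inE eE.
  right; have /fintype.subsetP eC := component_closed gE fC eE nde.
  have /forall_inP/(_ e eE)/cards2P[a [b [_ eab]]] := gE.
  have /imsetP[x _ ax] : a \in (f @: [set: U])%SET by apply: eC; rewrite eab set21.
  have /imsetP[y _ byy] : b \in (f @: [set: U])%SET by apply: eC; rewrite eab set22.
  apply/imsetP; exists [set x; y]%SET; last by rewrite imsetU1 imset_set1 -ax -byy.
  by have := fE x y; rewrite /adj -ax -byy -eab eE.
case=> [|/imsetP[s sH ->]]; first by rewrite inE => /andP[].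
have /cards2P[x [y [_ sxy]]] := gH s sH.
by have := fE x y; rewrite /adj -sxy sH sxy imsetU1 imset_set1.
Qed.

Lemma card_embeds (U T : finType) (EH : {set {set U}}) (E : {set {set T}}) f :
  is_graph EH -> is_graph E -> embeds EH E f ->
  #|E| = #|outside E (f @: [set: U])%SET| + #|EH|.
Proof.
move=> gH gE ef; rewrite {1}(embeds_split gH gE ef) cardsU.
have [fi _ _] := ef; rewrite (_ : _ :&: _ = finset.set0)%SET.
  rewrite cards0 subn0; congr (_ + _). by apply: card_imset; exact: imset_inj.
apply/setP => e; rewrite !inE; apply/negP => /andP[/andP[_ de] /imsetP[s sH es]].
move/forall_inP: gH => /(_ s sH)/cards2P[x [y [_ sxy]]].
have := disjointFr de (_ : f x \in e); rewrite es imset_f ?sxy ?set21 // => /(_ isT).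
by rewrite imset_f.
Qed.

(** In the dissolved graph each vertex [f u] of the former component hangs as a leaf at [g u]. *)
Definition attach (U T : finType) (F : {set {set T}}) (f g : U -> T) : {set {set T}} :=
  (F :|: [set [set f u; g u] | u : U])%SET.

Lemma attach_graph (U T : finType) (EH : {set {set U}}) n m (E : {set {set 'I_n}})
    (f g : {ffun U -> 'I_n}) :
  is_graph EH -> E \in planar_graphs R n m -> embeds EH E f ->
  (forall u, g u \notin (f @: [set: U])%SET) ->
  attach (outside E (f @: [set: U])%SET) f g \in planar_graphs R n (m - #|EH| + #|U|).
Proof.
move=> gH /planar_graphsP[gE mE pE] ef gC; have [fi _ _] := ef.
have gf u v : g u != f v by apply: contraNneq (gC u) => ->; rewrite imset_f.
set F := outside _ _.
have FE : F \subset E by apply/fintype.subsetP => e; rewrite inE => /andP[].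
have isoF u : isolated (enum F) (f u).
  move=> e; rewrite mem_enum inE => /andP[_ de].
  by rewrite (disjointFl de) // imset_f.
have pairI : injective (fun u => [set f u; g u]%SET).
  move=> u v /set2_inj[[/fi//]|[fg _]].
  by have := gf v u; rewrite -fg eqxx.
have notF u : [set f u; g u]%SET \notin F.
  by apply/negP; rewrite -mem_enum => /(isoF u); rewrite set21.
apply/planar_graphsP; split.
- apply/forall_inP => e; rewrite inE => /orP[/(fintype.subsetP FE)|/imsetP[u _ ->]].
    by move/forall_inP: gE; exact.
  by rewrite cards2 (eq_sym (f u)) gf.
- rewrite cardsU card_imset // (_ : _ :&: _ = finset.set0)%SET.
    by rewrite cards0 subn0 -mE (card_embeds gH gE ef) addnK.
  apply/setP => e; rewrite !inE; apply/negP => /andP[eF /imsetP[u _ eE]].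
  by move: (notF u); rewrite -eE inE eF.
- apply/planarP; move/planarP/(plan_enumS FE): pE => pF.
  apply: (plan_perm _ (plan_pendants (enum_uniq U) fi gf isoF pF)).
  apply: uniq_perm => [||e]; rewrite ?enum_uniq //.
    rewrite cat_uniq map_inj_uniq // !enum_uniq andbT /=.
    apply/hasPn => e; rewrite mem_enum => eF; apply/mapP => -[u _ eE].
    by move: (notF u); rewrite -eE eF.
  rewrite mem_cat !mem_enum finset.in_setU orbC; congr (_ || _).
  apply/mapP/imsetP => -[u _ ->]; exists u => //; exact: mem_enum.
Qed.

(** The map [f] tells the leaves. The edges that avoid them form the outside part, [EH] refills the
    component, and [g u] is the only neighbour of [f u]. *)
Lemma attach_inj (U T : finType) (EH : {set {set U}}) (E E' : {set {set T}})
    (f g g' : {ffun U -> T}) :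
  is_graph EH -> is_graph E -> is_graph E' -> embeds EH E f -> embeds EH E' f ->
  (forall u, g u \notin (f @: [set: U])%SET) ->
  (forall u, g' u \notin (f @: [set: U])%SET) ->
  attach (outside E (f @: [set: U])%SET) f g = attach (outside E' (f @: [set: U])%SET) f g' ->
  E = E' /\ g = g'.
Proof.
move=> gH gE gE' ef ef' gC gC' eqA; set C := (f @: [set: U])%SET in gC gC' eqA *.
have [fi _ _] := ef.
have fC u : f u \in C by rewrite imset_f.
have out (G : {set {set T}}) (h : {ffun U -> T}) : outside G C =
    outside (attach (outside G C) f h) C.
  apply/setP => e; rewrite !inE; case: (boolP [disjoint e & C]) => de; rewrite ?andbF //.
  rewrite !andbT orbC; case: imsetP => // -[u _ eE].
  by have := disjointFr de (_ : f u \in e); rewrite eE set21 fC => /(_ isT).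
split.
  rewrite (embeds_split gH gE ef) (embeds_split gH gE' ef') -/C.
  by rewrite (out E g) eqA -out.
apply/ffunP => u; have : [set f u; g u]%SET \in attach (outside E C) f g.
  by rewrite inE (imset_f (fun u => [set f u; g u]%SET)) ?orbT.
rewrite eqA inE => /orP[|/imsetP[v _ /set2_inj[[/fi -> ->//]|[fg _]]]].
  rewrite inE => /andP[_ de].
  by have := disjointFr de (set21 (f u) (g u)); rewrite fC.
by have := gC' v; rewrite -fg fC.
Qed.

(** Each graph admits [(n - #|U|) ^ #|U|] choices of [g]. The outcome together with [f] determines
    the graph and [g], and there are [n ^ #|U|] maps [f]. *)
Lemma component_count (U : finType) (EH : {set {set U}}) n m : is_graph EH ->
  #|[set E in planar_graphs R n m | has_component_iso EH E]%SET| * (n - #|U|) ^ #|U| <=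
  n ^ #|U| * #|planar_graphs R n (m - #|EH| + #|U|)|.
Proof.
move=> gH; set A := [set E in _ | _]%SET.
have [->|[E0 E0A]] := set_0Vmem A; first by rewrite cards0 mul0n.
have AP E : E \in A -> exists f, embeds EH E f.
  by rewrite inE => /andP[_ /has_component_isoP].
(* One embedding is fixed per graph, so that graphs and not embeddings are counted. *)
have [F FP] : {F : {set {set 'I_n}} -> {ffun U -> 'I_n} &
    forall E, E \in A -> embeds EH E (F E)}.
  apply: (@choice _ _ (fun E f => E \in A -> embeds EH E f)) => E.
  have [/AP[f ef]|nEA] := boolP (E \in A); first by exists f.
  by have [f0 _] := AP E0 E0A; exists f0.
pose C E := (F E @: [set: U])%SET.
pose G E := [set g : {ffun U -> 'I_n} | [forall u, g u \notin C E]]%SET.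
have cG E : E \in A -> #|G E| = (n - #|U|) ^ #|U|.
  move=> EA; have [fi _ _] := FP E EA.
  have cC : #|C E| = #|U| by rewrite card_imset // finset.cardsT.
  have cC' : #|~: C E|%SET = n - #|U|.
    by rewrite -cC -[n in n - _](card_ord n) -(cardsC (C E)) addKn.
  rewrite -cC' -card_ffun_on; apply: eq_card => g; rewrite inE.
  apply/forallP/ffun_onP => gC u; last by have := gC u; rewrite inE.
  by rewrite inE gC.
pose X := [set z : {set {set 'I_n}} * {ffun U -> 'I_n} | (z.1 \in A) && (z.2 \in G z.1)]%SET.
have -> : #|A| * (n - #|U|) ^ #|U| = #|X|.
  by rewrite card_dep_pairs -sum_nat_const; apply: eq_bigr => E /cG.
pose h (z : {set {set 'I_n}} * {ffun U -> 'I_n}) :=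
  (attach (outside z.1 (C z.1)) (F z.1) z.2, F z.1).
have XP z : z \in X -> [/\ z.1 \in planar_graphs R n m, embeds EH z.1 (F z.1) &
    forall u, z.2 u \notin C z.1].
  rewrite inE => /andP[zA]; rewrite inE => /forallP zG; split => //; last exact: FP.
  by move: zA; rewrite inE => /andP[].
rewrite -(@card_in_imset _ _ h X); last first.
  move=> [E g] [E' g'] /XP[/= /planar_graphsP[gE _ _] ef gC].
  move=> /XP[/= /planar_graphsP[gE' _ _] ef' gC'] [+ eF].
  rewrite /C -eF in ef' gC' * => eA.
  by have [-> ->] := attach_inj gH gE gE' ef ef' gC gC' eA.
have <- : #|finset.setX (planar_graphs R n (m - #|EH| + #|U|)) [set: {ffun U -> 'I_n}]%SET| =
    n ^ #|U| * #|planar_graphs R n (m - #|EH| + #|U|)|.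
  by rewrite cardsX finset.cardsT card_ffun card_ord mulnC.
apply/subset_leq_card/fintype.subsetP => _ /imsetP[z /XP[zP ef gC] ->].
rewrite finset.in_setX /= [X in _ && X]inE andbT.
by apply: attach_graph.
Qed.

Lemma component_bound (U : finType) (EH : {set {set U}}) J :
  is_graph EH -> #|U| < #|EH| -> 0 < J ->
  exists q n0, 0 < q /\ forall n m, n0 <= n -> q * m <= q.+1 * n ->
  J * #|[set E in planar_graphs R n m | has_component_iso EH E]%SET| <=
  2 ^ #|U| * #|planar_graphs R n m|.
Proof.
move=> gH multi J0.
have [|q [n0 [q0 growth]]] := @graph_count_growth_iter J (#|EH| - #|U|) J0.
  by rewrite subn_gt0.
exists q, (n0 + 2 * #|U|); split => // n m nn qm.
have n0n : n0 <= n by apply: leq_trans nn; exact: leq_addr.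
have hn : 2 * #|U| <= n by apply: leq_trans nn; exact: leq_addl.
set A := [set E in _ | _]%SET.
(* For [m < #|EH|] truncated subtraction would spoil the number of edges, but then no graph has room
   for the component. *)
have [mk|km] := ltnP m #|EH|.
  rewrite (_ : A = finset.set0) ?cards0 ?muln0 //; apply/setP => E; rewrite inE finset.in_set0.
  apply/negP => /andP[/planar_graphsP[gE mE _] /has_component_isoP[f ef]].
  by move: mk; rewrite -mE (card_embeds gH gE ef) ltnNge leq_addl.
have := component_count n m gH; rewrite -/A.
rewrite (_ : m - #|EH| + #|U| = m - (#|EH| - #|U|)); last by rewrite subnBA ?addnBAC // ltnW.
have cm : #|EH| - #|U| <= m by apply: leq_trans km; exact: leq_subr.
have := growth n m n0n cm qm.
set N := #|planar_graphs _ _ _|; set N' := #|planar_graphs _ _ _| => JN AN.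
(* By [hn], [n] is at most twice [n - #|U|]. *)
have h1 : n ^ #|U| <= 2 ^ #|U| * (n - #|U|) ^ #|U|.
  by rewrite -expnMn; case: (posnP #|U|) => [->//|U0]; rewrite leq_exp2r //; lia.
have h0 : 0 < (n - #|U|) ^ #|U|.
  by rewrite expn_gt0; case: eqP => // /eqP; lia.
have : #|A| <= 2 ^ #|U| * N.
  rewrite -(leq_pmul2r h0); apply: leq_trans AN _.
  by rewrite mulnAC leq_mul2r h1 orbT.
by rewrite -(leq_pmul2l J0) => /leq_trans; apply; rewrite mulnCA leq_mul2l JN orbT.
Qed.

End Counting.

(** * Convergence of the probability to zero *)

Theorem theorem4p1 (R : realType) (U : finType) (EH : {set {set U}})
    (graphH : is_graph EH) (planarH : planar R EH) (multiH : multicyclic EH)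
    (m : nat -> nat) (eps : nat -> R)
    (eps_to_0 : eps n @[n --> \oo] --> (0 : R))
    (m_le : \forall n \near \oo, (m n)%:R <= (1 + eps n) * n%:R) :
  uniform_probability R (planar_graphs R n (m n)) (has_component_iso EH)
    @[n --> \oo] --> (0 : R).
Proof.
apply/cvgrPdist_lt => e e0.
have a0 : 0 < (2 ^+ #|U| : R) / e by rewrite divr_gt0 // exprn_gt0.
(* This makes [2 ^ #|U| / J] smaller than [e]. *)
pose J := (Num.truncn ((2 ^+ #|U| : R) / e)).+1.
have J0 : (0 : R) < J%:R by rewrite ltr0n.
have aJ : (2 ^+ #|U| : R) / e < J%:R by apply: truncnS_gt.
have [q [n0 [q0 bound]]] := component_bound R graphH multiH.2 (ltn0Sn _ : (0 < J)%N).
have q0R : (0 : R) < q%:R by rewrite ltr0n.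
have qV : (0 : R) < q%:R^-1 by rewrite invr_gt0.
(* Once [eps n] is below [1 / q], the bound [m_le] gives [q * m n <= q.+1 * n]. *)
move/cvgrPdist_lt : eps_to_0 => /(_ _ qV) eps_q.
near=> n.
have nn : (n0 <= n)%N by near: n; exact: nbhs_infty_ge.
have mn : (m n)%:R <= (1 + eps n) * n%:R by near: n.
have en : `|0 - eps n| < q%:R^-1 by near: n.
have qm : (q * m n <= q.+1 * n)%N.
  rewrite -(ler_nat R) !natrM -natr1.
  have en' : eps n <= q%:R^-1.
    by apply/ltW/(le_lt_trans _ en); rewrite sub0r normrN ler_norm.
  have : (q%:R : R) * (m n)%:R <= q%:R * ((1 + q%:R^-1) * n%:R).
    rewrite ler_pM2l //; apply: le_trans mn _; rewrite ler_wpM2r //.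
    by rewrite lerD2l.
  by rewrite mulrA mulrDr mulr1 divff // lt0r_neq0.
have {bound} := bound n (m n) nn qm; rewrite /uniform_probability.
set A := #|_|; set N := #|_| => AN.
rewrite sub0r normrN ger0_norm ?divr_ge0 //.
(* Without any graph the quotient is zero, because the inverse of zero is zero. *)
have [->|N0] := posnP N; first by rewrite invr0 mulr0.
rewrite ltr_pdivrMr ?ltr0n // -(ltr_pM2l J0).
have : (J * A)%:R <= (2 ^ #|U| * N)%:R :> R by rewrite ler_nat.
rewrite !natrM natrX => /le_lt_trans; apply.
rewrite mulrA ltr_pM2r ?ltr0n //.
by rewrite -ltr_pdivrMr.
Unshelve. all: by end_near.
Qed.
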